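(* $\beta(n,p,4)\le O\left(n+n^{3/4}p^{1/2}+n^{2-\sqrt2+o(1)}p^{1/\sqrt2}+p\right)$; that is, every $4$-bridge-free acyclic path system with at most $n$ nodes and at most $p$ paths has size bounded by the right-hand side.
   Context: A path system is a pair $(V,\Pi)$ with $\Pi$ a collection of nonempty vertex sequences (paths); its size is $\sum_{\pi\in\Pi}|\pi|$, $|\pi|$ being the number of vertices of $\pi$. It is acyclic if some total order on $V$ agrees with the vertex order within every path. A subsystem is obtained by deleting paths, deleting nodes, or deleting single occurrences of nodes from paths. A $k$-bridge is a system with nodes $x_1,\dots,x_k$ and $k$ two-node paths: the river $(x_1,x_k)$ and arcs $(x_i,x_{i+1})$, $1\le i<k$; degenerate occurrences count (e.g. two paths sharing two nodes in the same order form a $2$-bridge). A system is $k$-bridge-free if it has no $j$-bridge subsystem for any $2\le j\le k$. $\beta(n,p,4)$ is the maximum size of a $4$-bridge-free (acyclic) path system with $n$ nodes and $p$ paths. *)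

(* Defs.v *)
From HB Require Import structures.
From mathcomp Require Import all_boot all_order all_algebra.
From mathcomp Require Import all_classical all_reals all_analysis.
Import Order.TTheory GRing.Theory Num.Theory numFieldNormedType.Exports.

Set Implicit Arguments.
Unset Strict Implicit.
Unset Printing Implicit Defensive.

(* The vertex set is a subset of an ambient finite type, so that a system and
   its subsystems live over the same type. The list of paths stands for a
   multiset: the same vertex sequence may occur as several paths, as it does
   in a 2-bridge, whose river and only arc are equal as sequences. *)
Record path_system (T : finType) := PathSystem {
  nodes : {set T};
  paths : seq (seq T);
  pathsP : all (fun pi => (pi != [::]) && all (mem nodes) pi) paths
}.

Definition system_size (T : finType) (S : path_system T) : nat :=
  \sum_(pi <- paths S) size pi.

(* [lt] is a strict total order; since it is transitive, [sorted lt pi] says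
   that any two entries of pi are in increasing order. In particular the paths
   of an acyclic system do not repeat nodes. *)
Definition acyclic (T : finType) (S : path_system T) : Prop :=
  exists lt : rel T,
    [/\ irreflexive lt, transitive lt,
        {in nodes S &, forall u v, [|| u == v, lt u v | lt v u]} &
        all (sorted lt) (paths S)].

(* S' arises from S by deletions: [ps] is what remains after deleting whole
   paths, every remaining path loses some occurrences, and nodes may be
   removed. By [pathsP S'] a removed node has lost all its occurrences, and a
   path which loses all its entries has to be deleted. *)
Definition subsystem (T : finType) (S' S : path_system T) : Prop :=
  nodes S' \subset nodes S /\
  exists2 ps, subseq ps (paths S) & all2 subseq (paths S') ps.

(* The nodes x_1, ..., x_k are the entries of x :: s. *)
Definition bridge (T : finType) (k : nat) (S : path_system T) : Prop :=
  exists (x : T) (s : seq T),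
    [/\ size (x :: s) = k, uniq (x :: s), nodes S =i x :: s &
        perm_eq (paths S)
          ([:: x; last x s] :: pairmap (fun y z => [:: y; z]) x s)].

Definition bridge_free (T : finType) (k : nat) (S : path_system T) : Prop :=
  forall (j : nat) (S' : path_system T),
    2 <= j <= k -> subsystem S' S -> ~ bridge j S'.

(* The supremum is a maximum: acyclic paths have at most n nodes each, so the
   sizes are natural numbers bounded by n * p, and the empty system counts. *)
Definition beta (R : realType) (n p k : nat) : \bar R :=
  ereal_sup [set b : \bar R | exists (T : finType) (S : path_system T),
    [/\ #|nodes S| <= n, size (paths S) <= p, acyclic S, bridge_free k S &
        b = (system_size S)%:R%:E]].

(* Main.v *)
(* Suppose that l nodes lie on each of P paths and D paths pass through
   each node. A ladder from a path p to a path q is the set of rungs, the paths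
   crossing p before they cross q; because there are no 4-bridges, the rungs
   meet p and q in the same order. On average a ladder has about
   t = D^2 l^2 / P rungs, so after cutting all paths into blocks of length about
   m = l / t, most rungs share both blocks with another rung of the same ladder.
   Fix a path s and let M be the union of the blocks around s on the paths that
   cross s. Sending a rung on s to its partner shows that the system restricted
   to M, which has at most l D m nodes, contains about D^2 l^2 collinear pairs.
   The bound for this smaller system, applied to the number of its paths of
   length at least k for every k, limits these pairs and gives t^g <= O(l^2) with
   g = 2 + sqrt 2, that is, P <= O(n^2 / l^g). The exponent g is the fixed point
   of g -> 4 - 2 / g reached by this recursion, and since the constant enters
   the recursion with the power 1 / g < 1 it is preserved exactly. Hence the
   bound holds with e = 0. *)
Require Import Defs.
From HB Require Import structures.
From mathcomp Require Import all_boot all_order all_algebra.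
From mathcomp Require Import all_classical all_reals all_analysis.
From mathcomp Require Import zify ring lra.
Import Order.TTheory GRing.Theory Num.Theory numFieldNormedType.Exports.

Set Implicit Arguments.
Unset Strict Implicit.
Unset Printing Implicit Defensive.

(** * Bridge-free families of ranked sets *)

(* A path is encoded by the set of its nodes; the rank [r] orders every path. *)
Definition hop (V I : finType) (r : V -> nat) (A : I -> {set V}) i x y :=
  [&& x \in A i, y \in A i & r x < r y].

(** Only the path indices have to be distinct: paths with equal node sets count as different, and
    the strict ranks already separate the nodes of a bridge. In the last two clauses the last index
    is the river. *)
Definition bridgeless (V I : finType) (r : V -> nat) (A : I -> {set V}) : Prop :=
  [/\ forall i, {in A i &, injective r},
      forall i j x y, i != j -> hop r A i x y -> hop r A j x y -> False,
      forall i j k x y z, uniq [:: i; j; k] ->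
        hop r A i x y -> hop r A j y z -> hop r A k x z -> False &
      forall i j k l x y z t, uniq [:: i; j; k; l] ->
        hop r A i x y -> hop r A j y z -> hop r A k z t -> hop r A l x t ->
        False].

Lemma bridgeless_meet (V I : finType) (r : V -> nat) (A : I -> {set V}) i j x y :
  bridgeless r A -> i != j -> x \in A i -> y \in A i -> x \in A j -> y \in A j ->
  x = y.
Proof.
case=> injr no2 _ _ neij xi yi xj yj.
case: (ltngtP (r x) (r y)) => [lt|lt|E]; last exact: (injr i).
- by case: (no2 i j x y neij); rewrite /hop ?xi ?yi ?xj ?yj.
- by case: (no2 i j y x neij); rewrite /hop ?xi ?yi ?xj ?yj.
Qed.

(** Otherwise the three meeting points are distinct, and however the ranks order them, the path
    through the lowest and the highest is the river of a 3-bridge whose arcs are the other two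
    paths. *)
Lemma bridgeless_triangle (V I : finType) (r : V -> nat) (A : I -> {set V})
    i j k x y z :
  bridgeless r A -> uniq [:: i; j; k] ->
  x \in A i -> x \in A j -> y \in A j -> y \in A k -> z \in A i -> z \in A k ->
  x = y.
Proof.
move=> br u xi xj yj yk zi zk; apply/eqP/negP => /negP nexy.
have [injr _ no3 _] := br.
have [nij njk nik] : [/\ i != j, j != k & i != k].
  by move: u; rewrite /= !inE negb_or andbT => /andP[/andP[-> ->] ->].
have nexz : x != z.
  apply/eqP => E; case/eqP: nexy; subst z.
  exact: (bridgeless_meet br njk xj yj zk yk).
have neyz : y != z.
  apply/eqP => E; case/eqP: nexy; subst z.
  exact: (bridgeless_meet br nij xi zi xj yj).
have rxy : r x != r y by apply: contraNneq nexy => /(injr j _ _ xj yj)->.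
have rxz : r x != r z by apply: contraNneq nexz => /(injr i _ _ xi zi)->.
have ryz : r y != r z by apply: contraNneq neyz => /(injr k _ _ yk zk)->.
have U : [/\ uniq [:: i; k; j], uniq [:: j; i; k], uniq [:: j; k; i],
             uniq [:: k; i; j] & uniq [:: k; j; i]].
  by move: nij njk nik; rewrite /= !inE !negb_or ![k == _]eq_sym ![j == i]eq_sym
     => -> -> ->.
case: U => u1 u2 u3 u4 u5.
clear nij njk nik nexy nexz neyz br.
case: (ltngtP (r x) (r y)) rxy => // lxy _.
  case: (ltngtP (r y) (r z)) ryz => // lyz _.
    by apply: (no3 j k i x y z) => //; apply/and3P; split=> //; apply: ltn_trans lyz.
  case: (ltngtP (r x) (r z)) rxz => // lxz _.
    by apply: (no3 i k j x z y) => //; apply/and3P; split.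
  by apply: (no3 i j k z x y) => //; apply/and3P; split.
case: (ltngtP (r y) (r z)) ryz => // lyz _.
  case: (ltngtP (r x) (r z)) rxz => // lxz _.
    by apply: (no3 j i k y x z) => //; apply/and3P; split.
  by apply: (no3 k i j y z x) => //; apply/and3P; split.
by apply: (no3 k j i z y x) => //; apply/and3P; split=> //; apply: ltn_trans lxy.
Qed.

(** Covers restriction to subsets, cutting into pieces and copying of nodes at once. Consecutive
    paths of a bridge share a node, so their images under [f] stay distinct and the bridge survives
    in [A]. *)
Lemma bridgeless_refine (V V' I I' : finType) (r : V -> nat) (A : I -> {set V})
    (A' : I' -> {set V'}) (f : I' -> I) (g : V' -> V) :
  bridgeless r A ->
  (forall i, {in A' i &, injective g}) ->
  (forall i v, v \in A' i -> g v \in A (f i)) ->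
  (forall i j v, v \in A' i -> v \in A' j -> f i = f j -> i = j) ->
  bridgeless (r \o g) A'.
Proof.
move=> [injr no2 no3 no4] injg sub inj.
have H i x y : hop (r \o g) A' i x y -> hop r A (f i) (g x) (g y).
  by case/and3P => xi yi lt; apply/and3P; split => //; apply: sub.
have D i j v : i != j -> v \in A' i -> v \in A' j -> f i != f j.
  by move=> nij vi vj; apply: contraNneq nij => /(inj _ _ v vi vj)->.
split.
- move=> i x y xi yi /(injr (f i) _ _ (sub _ _ xi) (sub _ _ yi)).
  exact: (injg i).
- move=> i j x y nij hi hj; apply: (no2 (f i) (f j) _ _ _ (H _ _ _ hi) (H _ _ _ hj)).
  by case/and3P: hi => xi _ _; case/and3P: hj => xj _ _; apply: (D _ _ x).
- move=> i j k x y z u hi hj hk.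
  apply: (no3 (f i) (f j) (f k) _ _ _ _ (H _ _ _ hi) (H _ _ _ hj) (H _ _ _ hk)).
  move: u; rewrite /= !inE !negb_or !andbT => /andP[/andP[nij nik] njk].
  case/and3P: hi => xi yi _; case/and3P: hj => yj zj _; case/and3P: hk => xk zk _.
  by rewrite (D _ _ y nij) ?(D _ _ x nik) ?(D _ _ z njk).
- move=> i j k l x y z t u hi hj hk hl.
  move: u; rewrite /= !inE !negb_or !andbT.
  move=> /andP[/and3P[nij nik nil] /andP[/andP[njk njl] nkl]].
  have [xi yi rxy] := and3P hi; have [yj zj ryz] := and3P hj.
  have [zk tk rzt] := and3P hk; have [xl tl rxt] := and3P hl.
  have fij := D _ _ y nij yi yj; have fjk := D _ _ z njk zj zk.
  have fkl := D _ _ t nkl tk tl; have fil := D _ _ x nil xi xl.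
  (* Opposite paths of a 4-bridge need not share a node. If their images coincided, that image would
     share two nodes with a third path, which is a 2-bridge. *)
  have fik : f i != f k.
    apply/eqP => E; apply: (no2 _ _ _ _ fkl _ (H _ _ _ hl)).
    by apply/and3P; split; [rewrite -E sub | rewrite sub | exact: rxt].
  have fjl : f j != f l.
    apply/eqP => E; apply: (no2 _ _ _ _ fij (H _ _ _ hi)).
    by apply/and3P; split; [rewrite E sub | rewrite sub | exact: rxy].
  apply: (no4 (f i) (f j) (f k) (f l) _ _ _ _ _ (H _ _ _ hi) (H _ _ _ hj)
           (H _ _ _ hk) (H _ _ _ hl)).
  by rewrite /= !inE !negb_or fij fik fil fjk fjl fkl.
Qed.

(** * Counting by injective relations, positions and blocks *)

(** An injection in the form of a relation: a value is picked for each element, so the partner of a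
    rung need not be constructed as a function. *)
Lemma leq_card_rel (T U : finType) (X : {set T}) (Y : {set U}) (R : T -> U -> Prop) :
  (forall a, a \in X -> exists2 b, b \in Y & R a b) ->
  (forall a a' b, a \in X -> a' \in X -> R a b -> R a' b -> a = a') ->
  #|X| <= #|Y|.
Proof.
move=> tot inj.
have [->|[a0 a0X]] := set_0Vmem X; first by rewrite cards0.
have [b0 _ _] := tot _ a0X.
pose F a := odflt b0 [pick b in Y | `[< R a b >]].
have FP a : a \in X -> F a \in Y /\ R a (F a).
  move=> aX; rewrite /F; case: pickP => [b /andP[bY /asboolP]|none] //=.
  by have [b bY Rab] := tot _ aX; have := none b; rewrite bY /= => /asboolP.
rewrite -(card_in_imset (f := F)).
  by apply/subset_leq_card/fintype.subsetP => _ /imsetP[a aX ->]; case: (FP _ aX).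
move=> a a' aX a'X E; apply: (inj a a' (F a)) => //; first by case: (FP _ aX).
by rewrite E; case: (FP _ a'X).
Qed.

(** The position of [x] along [X], counted from 0; its quotient by [m] is the number of the block of
    [x]. *)
Definition pos (V : finType) (r : V -> nat) (X : {set V}) x :=
  #|[set y in X | r y < r x]|.

Lemma pos_ltn_card (V : finType) (r : V -> nat) (X : {set V}) x :
  x \in X -> pos r X x < #|X|.
Proof.
move=> xX; apply: proper_card; apply/properP; split.
  by apply/fintype.subsetP => y; rewrite inE => /andP[].
by exists x; rewrite // inE ltnn andbF.
Qed.

Lemma pos_ltn (V : finType) (r : V -> nat) (X : {set V}) x y :
  x \in X -> r x < r y -> pos r X x < pos r X y.
Proof.
move=> xX lt; apply: proper_card; apply/properP; split.
  apply/fintype.subsetP => z; rewrite !inE => /andP[-> /= ltz].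
  exact: ltn_trans lt.
by exists x; rewrite inE xX /= ?lt // ltnn.
Qed.

Lemma pos_inj (V : finType) (r : V -> nat) (X : {set V}) :
  {in X &, injective r} -> {in X &, injective (pos r X)}.
Proof.
move=> injr x y xX yX E.
case: (ltngtP (r x) (r y)) => [lt|lt|Er]; last exact: injr.
- by have := pos_ltn xX lt; rewrite E ltnn.
- by have := pos_ltn yX lt; rewrite E ltnn.
Qed.

(** Positions with the same quotient by [m] are told apart by their remainders. *)
Lemma card_block (V : finType) (r : V -> nat) (X : {set V}) m a :
  {in X &, injective r} -> 0 < m -> #|[set y in X | pos r X y %/ m == a]| <= m.
Proof.
move=> injr m0; rewrite -[leqRHS]card_ord -cardsT.
apply: (leq_card_rel (R := fun y b => pos r X y %% m = val b)).
  move=> y _; have lt := ltn_pmod (pos r X y) m0.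
  by exists (Ordinal lt); rewrite ?inE.
move=> y z b; rewrite !inE => /andP[yX /eqP Ey] /andP[zX /eqP Ez] Fy Fz.
apply: (pos_inj injr) => //.
by rewrite (divn_eq (pos r X y) m) (divn_eq (pos r X z) m) Ey Ez Fy Fz.
Qed.

Lemma card_ordered_pairs (V : finType) (r : V -> nat) (X : {set V}) :
  {in X &, injective r} ->
  (#|[set u in finset.setX X X | r u.1 < r u.2]| * 2 + #|X| = #|X| ^ 2)%N.
Proof.
move=> injr.
rewrite -mulnn -cardsX.
have <- : #|[set u in finset.setX X X | u.1 == u.2]| = #|X|.
  rewrite -(card_in_imset (f := fun x : V => (x, x)) (D := X)); last by move=> x y _ _ [].
  apply: eq_card => -[x y]; rewrite !inE /=; apply/idP/imsetP.
    by move=> /andP[/andP[xX yX] /eqP E]; exists x; rewrite // -E.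
  by case=> z zX [-> ->]; rewrite zX eqxx.
have E2 : #|[set u in finset.setX X X | r u.2 < r u.1]| =
          #|[set u in finset.setX X X | r u.1 < r u.2]|.
  rewrite -[RHS](card_imset (f := fun u : V * V => (u.2, u.1))).
    apply: eq_card => -[x y]; rewrite !inE /=; apply/idP/imsetP.
      move=> /andP[/andP[xX yX] lt]; exists (y, x) => //.
      by rewrite !inE /= xX yX lt.
    by case=> -[a b]; rewrite !inE /= => /andP[/andP[aX bX] lt] [-> ->]; rewrite aX bX lt.
  by move=> [a b] [c d] [-> ->].
rewrite muln2 -addnn -{2}E2 -[RHS]sum1_card.
have C (P : pred (V * V)) :
    #|[set u in finset.setX X X | P u]| = \sum_(u in finset.setX X X) (P u : nat).
  rewrite -sum1_card big_mkcond [RHS]big_mkcond /=; apply: eq_bigr => u _.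
  by rewrite inE; case: (u \in _) => //; case: (P u).
rewrite !C -!big_split; apply: eq_bigr => -[x y] /=; rewrite inE /= => /andP[xX yX].
case: (x =P y) => [->|ne]; first by rewrite ltnn.
case: (ltngtP (r x) (r y)) => // E; case: ne; exact: injr.
Qed.

Lemma card_dep_pairs (T U : finType) (F : T -> {set U}) :
  #|[set q : T * U | q.2 \in F q.1]| = \sum_t #|F t|.
Proof.
rewrite -sum1_card (eq_bigl (fun q => xpredT q.1 && (q.2 \in F q.1))).
  rewrite -(pair_big_dep xpredT (fun t u => u \in F t) (fun _ _ => 1)) /=.
  by apply: eq_bigr => t _; rewrite sum1_card.
by move=> q; rewrite inE.
Qed.

(** * Ladders and the counting of their rungs *)

(* [s] and [s'] are two rungs of the ladder from the path [p] to the path [q]. *)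
Definition rungs (V I : finType) (r : V -> nat) (A : I -> {set V}) p q s x z s' x' z' :=
  [/\ uniq [:: s; s'; p] /\ uniq [:: s; s'; q],
      hop r A s x z /\ hop r A s' x' z',
      x \in A p /\ x' \in A p & z \in A q /\ z' \in A q].

(** Rungs with a common end would form a triangle with the opposite side of the ladder. Its corners
    coincide, although every rung strictly increases the rank. *)
Lemma rungs_neq (V I : finType) (r : V -> nat) (A : I -> {set V}) p q s x z s' x' z' :
  bridgeless r A -> rungs r A p q s x z s' x' z' -> x != x' /\ z != z'.
Proof.
move=> br [[up uq] [/and3P[xs zs ltxz] /and3P[xs' zs' ltxz']] [xp xp'] [zq zq']].
split; apply/eqP => E; subst.
- have E := bridgeless_triangle br uq xs xs' zs' zq' zs zq.
  by move: ltxz'; rewrite E ltnn.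
- have E := bridgeless_triangle br up zs zs' xs' xp' xs xp.
  by move: ltxz'; rewrite E ltnn.
Qed.

(** If the rungs crossed, [p] from [x] to [x'], [s'] on to [z'] and [q] on to [z] would be the arcs
    of a 4-bridge with river [s]. *)
Lemma rungs_mono (V I : finType) (r : V -> nat) (A : I -> {set V}) p q s x z s' x' z' :
  bridgeless r A -> rungs r A p q s x z s' x' z' -> r x < r x' -> r z < r z'.
Proof.
move=> br rg ltx; have [_ nez] := rungs_neq br rg.
case: rg => [[up uq] [hxz hxz'] [xp xp'] [zq zq']].
have [injr _ _ no4] := br; rewrite ltnNge; apply/negP => lez.
have ltz : r z' < r z.
  by rewrite ltn_neqAle lez andbT; apply: contraNneq nez => /(injr q _ _ zq' zq) ->.
move: up uq; rewrite /= !inE !negb_or !andbT => /andP[/andP[nss' nsp] ns'p].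
move=> /andP[/andP[_ nsq] ns'q].
have npq : p != q.
  apply/eqP => E; subst q; have [xs zs lt] := and3P hxz.
  by move: lt; rewrite (bridgeless_meet br nsp xs zs xp zq) ltnn.
have hp : hop r A p x x' by apply/and3P.
have hq : hop r A q z' z by apply/and3P.
apply: (no4 p s' q s _ _ _ _ _ hp hxz' hq hxz).
by rewrite /= !inE !negb_or [p == s']eq_sym [p == s]eq_sym [s' == s]eq_sym
  [q == s]eq_sym ns'p npq nsp ns'q nss' nsq.
Qed.

(** The left side counts the rungs of all ladders. A rung without a partner in its two blocks is
    charged to its ladder and a block number, any other rung to a collinear pair inside [M s]. *)
Lemma ladder_count (V I : finType) (r : V -> nat) (A : I -> {set V}) D l m :
  bridgeless r A -> (forall i, #|A i| <= l) ->
  (forall i v, v \in A i -> #|[set j | v \in A j]| = D) -> 0 < m ->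
  exists M : I -> {set V},
    (forall s, #|M s| <= l * D * m.-1) /\
    D.-1 ^ 2 * \sum_s #|[set u in finset.setX (A s) (A s) | r u.1 < r u.2]| <=
      2 * (l %/ m).+1 * #|I| ^ 2 + \sum_s \sum_j #|A j :&: M s| ^ 2.
Proof.
move=> br lenA deg m0.
pose S s := [set u in finset.setX (A s) (A s) | r u.1 < r u.2].
pose N s x := [set j | x \in A j] :\ s.
pose blk i x := pos r (A i) x %/ m.
pose near i x y := [&& y \in A i, y != x & blk i y == blk i x].
(* A branch at [s] is a node of [s] together with another path through it. [M s] collects the blocks
   around the branches, each without its own base node; hence the factor [m.-1], and [M s] is empty
   for [m = 1]. *)
pose Br s := [set b : V * I | (b.1 \in A s) && (b.2 \in N s b.1)].
pose M s := [set y | [exists b in Br s, near b.2 b.1 y]].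
exists M; split.
  move=> s; pose F b := [set y in A b.2 | pos r (A b.2) y %/ m == blk b.2 b.1] :\ b.1.
  apply: (leq_trans (n := \sum_(b in Br s) #|F b|)).
    apply: (leq_trans (n := #|[set q : (V * I) * V |
        q.2 \in (if q.1 \in Br s then F q.1 else finset.set0)]|)); last first.
      rewrite (card_dep_pairs (fun b => if b \in Br s then F b else finset.set0)).
      rewrite [leqRHS]big_mkcond; apply: leq_sum => b _.
      by case: ifP => // _; rewrite cards0.
    apply: (leq_card_rel (R := fun y q => q.2 = y)).
      move=> y; rewrite inE => /existsP[b /andP[bB /and3P[yA nyb yb]]].
      by exists (b, y) => //; rewrite inE /= bB !inE nyb yA.
    by move=> a a' b _ _ <- <-.
  apply: (leq_trans (n := \sum_(b in Br s) m.-1)).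
    apply: leq_sum => b; rewrite !inE => /and3P[_ _ bb].
    have [injr _ _ _] := br; have le := card_block (blk b.2 b.1) (injr b.2) m0.
    rewrite -ltnS (prednK m0); apply: leq_trans le.
    by rewrite [leqRHS](cardsD1 b.1) !inE bb eqxx add1n.
  rewrite sum_nat_const leq_mul2r; apply/orP; right.
  have -> : #|Br s| = #|[set q : V * I | q.2 \in
      (if q.1 \in A s then N s q.1 else finset.set0)]|.
    by apply: eq_card => q; rewrite !inE; case: (q.1 \in A s); rewrite /= !inE.
  rewrite (card_dep_pairs (fun x => if x \in A s then N s x else finset.set0)).
  rewrite (bigID (mem (A s))) /= [X in _ + X]big1; last first.
    by move=> x /negbTE ->; rewrite cards0.
  rewrite addn0; apply: (leq_trans (n := \sum_(x in A s) D)).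
    apply: leq_sum => x xs; rewrite xs -(deg s x xs).
    by apply/subset_leq_card/fintype.subsetP => j; rewrite !inE => /andP[].
  by rewrite sum_nat_const leq_mul2r lenA orbT.
(* An element of [W] is a rung from [x] to [z] on [s], in the ladder from [p] to [q]. Each ordered
   pair on [s] extends to [D.-1 ^ 2] of them. *)
pose W := [set w : (I * (V * V)) * (I * I) | w.2 \in
  (if w.1.2 \in S w.1.1 then finset.setX (N w.1.1 w.1.2.1) (N w.1.1 w.1.2.2)
   else finset.set0)].
have WE s x z p q : (((s, (x, z)), (p, q)) \in W) =
    [&& hop r A s x z, p != s, x \in A p, q != s & z \in A q].
  rewrite inE /= /hop; case E : (_ \in S s).
    by move: E; rewrite !inE /= => /andP[/andP[-> ->] ->]; rewrite -andbA.
  move: E; rewrite !inE /=; case: (x \in A s); case: (z \in A s) => //=.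
  by move=> ->.
have cardN s x : x \in A s -> #|N s x| = D.-1.
  move=> xs; have := cardsD1 s [set j | x \in A j].
  by rewrite inE xs (deg s x xs) add1n => ->.
have cardW : #|W| = D.-1 ^ 2 * \sum_s #|S s|.
  rewrite (card_dep_pairs (fun t => if t.2 \in S t.1 then
    finset.setX (N t.1 t.2.1) (N t.1 t.2.2) else finset.set0)) big_distrr /=.
  rewrite -(pair_bigA_idem (addn0 0) (fun s u => #|if u \in S s then
    finset.setX (N s u.1) (N s u.2) else finset.set0|)) /=.
  apply: eq_bigr => s _; rewrite -sum1_card big_distrr /= [RHS]big_mkcond /=.
  apply: eq_bigr => u _; case: ifP; last by rewrite cards0.
  by rewrite inE => /andP[]; rewrite inE => /andP[us1 us2] _; rewrite cardsX !cardN // muln1 mulnn.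
(* The partner path [j] meets the block of [x] on [p] and the block of [z] on [q], both away from
   the ends of the rung. *)
pose paired (w : (I * (V * V)) * (I * I)) :=
  [exists j, exists x, exists z, [&& x \in A j, z \in A j,
     near w.2.1 w.1.2.1 x & near w.2.2 w.1.2.2 z]].
rewrite -/(S _) -cardW -(cardsID [set w | paired w] W) addnC.
apply: leq_add.
- (* Rungs of one ladder are linearly ordered, so two of them for which the sums
     of the two block numbers agree lie in the same blocks. *)
  have -> : 2 * (l %/ m).+1 * #|I| ^ 2 = #|[set: (I * I) * 'I_(2 * (l %/ m).+1)]|.
    by rewrite cardsT !card_prod card_ord mulnC mulnn.
  apply: (leq_card_rel (R := fun w b => b.1 = w.2 /\
     val b.2 = blk w.2.1 w.1.2.1 + blk w.2.2 w.1.2.2)).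
    move=> [[s [x z]] [p q]]; rewrite finset.in_setD WE => /and3P[_ _ /and4P[_ xp _ zq]] /=.
    have blk_le i y : y \in A i -> blk i y <= l %/ m.
      by move=> yi; apply: leq_div2r; apply: leq_trans (lenA i); apply/ltnW/pos_ltn_card.
    have lt : blk p x + blk q z < 2 * (l %/ m).+1.
      by have := blk_le _ _ xp; have := blk_le _ _ zq; lia.
    by exists ((p, q), Ordinal lt); rewrite ?inE.
  move=> [[s [x z]] [p q]] [[s' [x' z']] [p' q']] [b c] /=.
  rewrite !finset.in_setD !WE !inE /= => /andP[np /and5P[hs ps xp qs zq]].
  move=> /andP[_ /and5P[hs' ps' xp' qs' zq']] [-> cE] [[Ep Eq]]; rewrite cE => E {b c cE}.
  subst p' q'; case: (eqVneq s s') => [Es|nss'].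
    subst s'; have [[xs zs _] [xs' zs' _]] := (and3P hs, and3P hs').
    rewrite (bridgeless_meet br ps xp xp' xs xs').
    by rewrite (bridgeless_meet br qs zq zq' zs zs').
  exfalso; have rg : rungs r A p q s x z s' x' z'.
    by split; rewrite // /= !inE !negb_or nss' 2![s == _]eq_sym 2![s' == _]eq_sym
      ps ps' qs qs'.
  have rg' : rungs r A p q s' x' z' s x z.
    by split; rewrite // /= !inE !negb_or [s' == s]eq_sym nss' 2![s == _]eq_sym 2![s' == _]eq_sym
      ps ps' qs qs'.
  have [nex nez] := rungs_neq br rg.
  have cells : blk p x = blk p x' /\ blk q z = blk q z'.
    have [injr _ _ _] := br.
    have mono i a c : a \in A i -> r a < r c -> blk i a <= blk i c.
      by move=> ai lt; apply: leq_div2r; apply/ltnW/pos_ltn.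
    case: (ltngtP (r x) (r x')) => [lt|lt|/(injr p _ _ xp xp')/eqP]; last first.
    - by rewrite (negbTE nex).
    - have := mono _ _ _ zq' (rungs_mono br rg' lt); have := mono _ _ _ xp' lt.
      by move: E; clear; lia.
    - have := mono _ _ _ zq (rungs_mono br rg lt); have := mono _ _ _ xp lt.
      by move: E; clear; lia.
  case: cells => cx cz; case/negP: np.
  apply/existsP; exists s'; apply/existsP; exists x'; apply/existsP; exists z'.
  have [-> -> _] := and3P hs'; rewrite /near xp' zq' cx cz !eqxx.
  by rewrite [x' == x]eq_sym [z' == z]eq_sym nex nez.
(* A paired rung on [s] is sent to the two points where its partner meets the blocks. Both lie in
   [M s], and the next claims recover the rung from them. *)
pose Z (t : I * I) := finset.setX (A t.2 :&: M t.1) (A t.2 :&: M t.1).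
have -> : \sum_s \sum_j #|A j :&: M s| ^ 2 =
    #|[set q : (I * I) * (V * V) | q.2 \in Z q.1]|.
  rewrite (card_dep_pairs Z) pair_bigA; apply: eq_bigr => -[s j] _.
  by rewrite cardsX mulnn.
apply: (leq_card_rel (R := fun w b => [/\ b.1.1 = w.1.1,
   near w.2.1 w.1.2.1 b.2.1 & near w.2.2 w.1.2.2 b.2.2])).
  move=> [[s [x z]] [p q]]; rewrite finset.in_setI WE inE.
  move=> /andP[/and5P[/and3P[xs zs _] ps xp qs zq]].
  move=> /existsP[j /existsP[x' /existsP[z' /and4P[x'j z'j nx nz]]]].
  exists ((s, j), (x', z')); last by split.
  rewrite !inE /= x'j z'j /=; apply/andP; split; apply/existsP.
    by exists (x, p); rewrite inE nx andbT /= xs !inE ps.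
  by exists (z, q); rewrite inE nz andbT /= zs !inE qs.
(* A node reached from two branches at [s] on different paths would be a corner of a triangle formed
   by [s], [p] and [p'], hence equal to its base node, which [near] excludes. *)
have uniq_branch s p x p' x' y : x \in A s -> x \in A p -> p != s ->
    x' \in A s -> x' \in A p' -> p' != s -> near p x y -> near p' x' y ->
    p = p' /\ x = x'.
  move=> xs xp ps xs' xp' ps' /and3P[yp nyx _] /and3P[yp' nyx' _].
  case: (eqVneq p p') => [Ep|npp'].
    by subst p'; split=> //; apply: (bridgeless_meet br ps).
  case/eqP: nyx; apply/esym.
  apply: (bridgeless_triangle (i := s) (j := p) (k := p') br _ xs xp yp yp' xs' xp').
  by rewrite /= !inE negb_or [s == p]eq_sym [s == p']eq_sym ps ps' npp'.
move=> [[s [x z]] [p q]] [[s' [x' z']] [p' q']] [[s0 j] [u v]].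
rewrite !finset.in_setI !WE /= => /andP[/and5P[/and3P[xs zs _] ps xp qs zq] _].
move=> /andP[/and5P[/and3P[xs' zs' _] ps' xp' qs' zq'] _] [-> nu nv] [Es nu' nv'].
subst s'.
have [-> ->] := uniq_branch _ _ _ _ _ _ xs xp ps xs' xp' ps' nu nu'.
by have [-> ->] := uniq_branch _ _ _ _ _ _ zs zq qs zs' zq' qs' nv nv'.
Qed.

(** * Chunks of sequences and equalising of degrees *)

Definition chunk (T : eqType) k c (s : seq T) := take k (drop (c * k) s).

Lemma size_chunk (T : eqType) k c (s : seq T) :
  c.+1 * k <= size s -> size (chunk k c s) = k.
Proof.
by move=> le; rewrite size_takel // size_drop; move: le; rewrite mulSn; lia.
Qed.

Lemma mem_chunk (T : eqType) k c (s : seq T) x : x \in chunk k c s -> x \in s.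
Proof. by move=> /mem_take /mem_drop. Qed.

(** Hence chunks of a duplicate-free sequence with different numbers are disjoint. *)
Lemma index_chunk (T : eqType) k c (s : seq T) x :
  uniq s -> x \in chunk k c s -> index x s %/ k = c.
Proof.
move=> us /(nthP x)[i]; rewrite size_take_min size_drop leq_min => /andP[ik lt] <-.
rewrite nth_take // nth_drop index_uniq //; last by rewrite -ltn_subRL.
by rewrite divnMDl ?divn_small ?addn0 //; apply: leq_ltn_trans ik.
Qed.

(* A node is replaced by copies, one for each group of [D] paths through it; the
   at most [D - 1] remaining incidences at the node are dropped. *)
Lemma regularize_degrees (V I : finType) (r : V -> nat) (A : I -> {set V})
    (M : {set V}) l n D :
  bridgeless r A -> (forall i, #|A i| = l) -> (forall i, A i \subset M) ->
  #|M| <= n -> 0 < D ->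
  exists (V' : finType) (r' : V' -> nat) (A' : I -> {set V'}),
    [/\ bridgeless r' A', forall i, #|A' i| <= l,
        forall i v, v \in A' i -> #|[set j | v \in A' j]| = D &
        #|I| * l <= \sum_i #|A' i| + n * D.-1].
Proof.
move=> br lenA AM cardM D0.
pose E v := enum [set j | v \in A j].
(* At most [#|I|] paths pass through a node, so this many copies are enough. *)
pose V' : finType := (V * 'I_(#|I|.+1))%type.
(* Only full groups get a copy, so each copy in use lies on exactly [D] paths. *)
pose A' i := [set v : V' | (val v.2).+1 * D <= size (E v.1) & i \in chunk D (val v.2) (E v.1)].
have A'E i v : v \in A' i -> v.1 \in A i.
  by rewrite inE => /andP[_ /mem_chunk]; rewrite mem_enum inE.
have inj1 i : {in A' i &, injective fst}.
  move=> [v c] [v' c']; rewrite !inE /= => /andP[_ ic] /andP[_ ic'] Ev.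
  subst v'; congr pair; apply: val_inj => /=.
  by rewrite -(index_chunk (enum_uniq _) ic) (index_chunk (enum_uniq _) ic').
exists V', (r \o fst), A'; split.
- apply: (bridgeless_refine (f := id) br inj1 A'E) => //.
- move=> i; rewrite -(card_in_imset (inj1 i)) -(lenA i).
  by apply/subset_leq_card/fintype.subsetP => _ /imsetP[v vi ->]; apply: A'E.
- move=> i v; rewrite inE => /andP[le _].
  rewrite -[RHS](size_chunk le) -[RHS](card_uniqP _); last first.
    by rewrite take_uniq // drop_uniq // enum_uniq.
  by apply: eq_card => j; rewrite inE [in LHS]inE le.
have dbl (T : finType) (B : I -> {set T}) : \sum_i #|B i| = \sum_v #|[set j | v \in B j]|.
  under eq_bigr do rewrite -sum1_card big_mkcond /=.
  rewrite exchange_big /=; apply: eq_bigr => v _.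
  by rewrite -big_mkcond sum1dep_card; apply: eq_card => j; rewrite inE.
have -> : #|I| * l = \sum_v #|[set j | v \in A j]|.
  by rewrite -dbl (eq_bigr (fun=> l)) // sum_nat_const.
rewrite dbl.
have -> : \sum_(v : V') #|[set j | v \in A' j]| = \sum_v #|[set j | v \in A j]| %/ D * D.
  transitivity (\sum_v \sum_(c < #|I|.+1) #|[set j | ((v, c) : V') \in A' j]|).
    by rewrite pair_bigA; apply: eq_bigr => -[].
  apply: eq_bigr => v _; rewrite -[in RHS]sum1_card.
  have le : #|[set j | v \in A j]| %/ D <= #|I|.+1.
    by apply: (leq_trans (leq_div _ _)); apply: ltnW; rewrite ltnS max_card.
  rewrite sum1_card (eq_bigr (fun c : 'I_(#|I|.+1) =>
      if c < #|[set j | v \in A j]| %/ D then D else 0)).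
    by rewrite -big_mkcond -(big_ord_widen _ (fun=> D)) // sum_nat_const card_ord.
  move=> c _; have szE : size (E v) = #|[set j | v \in A j]| by rewrite -cardE.
  rewrite leq_divRL // -szE; case: ifP => le'.
    rewrite -[RHS](size_chunk le') -[RHS](card_uniqP _); last first.
      by rewrite take_uniq // drop_uniq // enum_uniq.
    by apply: eq_card => j; rewrite inE [in LHS]inE /= le'.
  by apply: eq_card0 => j; rewrite inE [in LHS]inE /= le'.
rewrite (bigID (mem M)) /= [X in _ + X]big1; last first.
  move=> v nvM; apply: eq_card0 => j; rewrite inE; apply: contraNF nvM.
  by apply: (fintype.subsetP (AM j)).
rewrite addn0.
have le1 : \sum_(v in M) #|[set j | v \in A j]| %/ D * D <=
           \sum_v #|[set j | v \in A j]| %/ D * D.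
  by rewrite [leqRHS](bigID (mem M)) leq_addr.
have le2 : #|M| * D.-1 <= n * D.-1 by rewrite leq_mul2r cardM orbT.
(* Each node of [M] loses only the remainder of its degree modulo [D]. *)
apply: leq_trans (leq_add le1 le2); rewrite -sum_nat_const -big_split.
apply: leq_sum => v _; rewrite {1}(divn_eq #|[set j | v \in A j]| D) leq_add2l.
by rewrite -ltnS prednK // ltn_pmod.
Qed.

(** * Sums of squares by levels *)

(** A square [b ^ 2] grows by less than [2 * b.+1] from [b] to [b.+1]. Charging these increments to
    the levels above [k0] and exchanging the sums counts the large indices; below [k0] one factor is
    replaced by [k0]. *)
Lemma sum_sqr_levels (I : finType) (L : I -> nat) k0 l :
  (forall i, L i <= l) ->
  \sum_i L i ^ 2 <=
    k0 * \sum_i L i + \sum_(k0 <= k < l) 2 * k.+1 * #|[set i | k < L i]|.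
Proof.
move=> Ll.
have sqr a b : a <= b -> b ^ 2 <= a * b + \sum_(a <= k < b) 2 * k.+1.
  elim: b => [|b IH]; first by rewrite leqn0 => /eqP->.
  rewrite leq_eqVlt => /orP[/eqP->|]; first by rewrite big_geq // addn0 mulnn.
  by rewrite ltnS => le; rewrite big_nat_recr //=; have := IH le; nia.
have -> : \sum_(k0 <= k < l) 2 * k.+1 * #|[set i | k < L i]| =
    \sum_i \sum_(k0 <= k < l | k < L i) 2 * k.+1.
  rewrite (exchange_big_dep xpredT) //=; apply: eq_bigr => k _.
  rewrite -sum1dep_card big_distrr /=; apply: eq_big => i; rewrite ?inE // => _; by rewrite muln1.
rewrite big_distrr -big_split /=; apply: leq_sum => i _.
case: (leqP (L i) k0) => [le|lt].
  by apply: leq_trans (leq_addr _ _); rewrite -mulnn leq_mul2r le orbT.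
apply: (leq_trans (sqr k0 (L i) (ltnW lt))); rewrite leq_add2l.
rewrite (big_nat_widen _ _ _ _ _ (Ll i)).
by apply: eq_leq; apply: eq_bigl => k.
Qed.

(** * From path systems to bridgeless families *)

Lemma subseq_pair (T : eqType) (lt : rel T) (s : seq T) x y :
  irreflexive lt -> transitive lt -> sorted lt s -> x \in s -> y \in s ->
  lt x y -> subseq [:: x; y] s.
Proof.
move=> irr tr; elim: s => // a s IH so; rewrite !inE.
have las : all (lt a) s := order_path_min tr so.
move=> /orP[/eqP->|xs] /orP[/eqP->|ys] ltxy.
- by rewrite irr in ltxy.
- by rewrite [subseq _ _]/= eqxx sub1seq.
- by have := tr _ _ _ ltxy (allP las _ xs); rewrite irr.
- by apply: subseq_trans (subseq_cons s a); apply: IH => //; apply: path_sorted so.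
Qed.

(** The paths of a bridge come in the order of its arcs, while [subsystem] follows the order of
    [paths S]. The indices are therefore sorted first, and the result is given up to permutation. *)
Lemma subsystem_of_paths (T : finType) (S : path_system T) (X : {set T})
    (idx : seq 'I_(size (paths S))) (bs : seq (seq T)) :
  uniq idx -> X \subset nodes S ->
  all (fun b => (b != [::]) && all (mem X) b) bs ->
  all2 (fun (i : 'I_(size (paths S))) b => subseq b (nth [::] (paths S) i)) idx bs ->
  exists S', [/\ nodes S' = X, subsystem S' S & perm_eq (paths S') bs].
Proof.
move=> uidx XS abs sub.
have szb : size idx = size bs by move: sub; rewrite all2E => /andP[/eqP].
pose h i := nth [::] bs (index i idx).
pose il := [seq i <- enum 'I_(size (paths S)) | i \in idx].
have mapE : map h idx = bs.
  apply: (@eq_from_nth _ [::]); rewrite size_map // => k lt.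
  (* [nth_map] needs a default index; 0 is one, since the existence of an entry of [idx] shows that
     the index type is inhabited. *)
  by rewrite (nth_map (Ordinal (leq_ltn_trans (leq0n _) (ltn_ord (tnth (in_tuple idx) (Ordinal lt)))))) // /h index_uniq.
have pe : perm_eq (map h il) bs.
  rewrite -mapE; apply: perm_map; apply: uniq_perm => //.
    by rewrite filter_uniq // enum_uniq.
  by move=> i; rewrite mem_filter mem_enum andbT.
have okP : all (fun b => (b != [::]) && all (mem X) b) (map h il).
  by rewrite (perm_all _ pe).
exists (PathSystem okP); split=> //; split=> //=.
exists [seq nth [::] (paths S) (val i) | i <- il].
  have E : [seq nth [::] (paths S) (val i) | i <- enum 'I_(size (paths S))] = paths S.
    by rewrite map_comp val_enum_ord -/(mkseq _ _) mkseq_nth.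
  by rewrite -[X in subseq _ X]E; apply: map_subseq; apply: filter_subseq.
have hs i : i \in idx -> subseq (h i) (nth [::] (paths S) i).
  move=> ii; have lt : index i idx < size idx by rewrite index_mem.
  move: sub; rewrite all2E => /andP[_ /(all_nthP (i, [::]))].
  move=> /(_ (index i idx)); rewrite size_zip -szb minnn => /(_ lt).
  by rewrite nth_zip // nth_index.
have : all (mem idx) il by apply/allP => i; rewrite mem_filter => /andP[].
by elim: il {pe okP} => //= i l IH /andP[ii /IH ->]; rewrite hs.
Qed.

Lemma bridgeless_paths (T : finType) (S : path_system T) :
  acyclic S -> bridge_free 4 S ->
  exists r : T -> nat,
    bridgeless r (fun i : 'I_(size (paths S)) => [set x in nth [::] (paths S) i]) /\
    forall i, i < size (paths S) -> uniq (nth [::] (paths S) i).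
Proof.
move=> [lt [irr tr tot so]] bf; set A := (fun i : 'I_(size (paths S)) => [set x in _]).
(* The rank of a node is the number of its predecessors in the given order. *)
pose r x := #|[set y in nodes S | lt y x]|.
have pN (i : 'I_(size (paths S))) x : x \in A i -> x \in nodes S.
  rewrite inE => xi; have /andP[_ /allP] := all_nthP [::] (pathsP S) i (ltn_ord i).
  exact.
have rlt x y : x \in nodes S -> lt x y -> r x < r y.
  move=> xN ltxy; apply: proper_card; apply/properP; split.
    apply/fintype.subsetP => z; rewrite !inE => /andP[-> /= /tr]; exact.
  by exists x; rewrite inE xN ?ltxy // irr.
have hopE i x y : hop r A i x y ->
    [/\ x \in nodes S, y \in nodes S, x != y & subseq [:: x; y] (nth [::] (paths S) i)].
  case/and3P=> xi yi ltr; have [xN yN] := (pN _ _ xi, pN _ _ yi).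
  have nxy : x != y by apply: contraTneq ltr => ->; rewrite ltnn.
  split=> //; apply: (subseq_pair irr tr); rewrite ?inE in xi yi *; [|done..|].
    exact: (all_nthP [::] so i (ltn_ord i)).
  case/or3P: (tot _ _ xN yN) => // [/eqP E|lyx]; first by rewrite E eqxx in nxy.
  by have := rlt _ _ yN lyx; rewrite ltnNge (ltnW ltr).
(* Every forbidden pattern is excluded by this claim; [idx] lists the path carrying the river first,
   then those carrying the arcs. *)
have main (idx : seq 'I_(size (paths S))) x (s : seq T) (bs : seq (seq T)) :
    uniq idx -> 2 <= size (x :: s) <= 4 -> uniq (x :: s) ->
    all (mem (nodes S)) (x :: s) ->
    bs = [:: x; last x s] :: pairmap (fun y z => [:: y; z]) x s ->
    all (fun b => (b != [::]) && all (mem [set y in x :: s]) b) bs ->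
    all2 (fun (i : 'I_(size (paths S))) b => subseq b (nth [::] (paths S) i)) idx bs -> False.
  move=> ui sz us sN bsE ok sub.
  have XS : [set y in x :: s] \subset nodes S.
    by apply/fintype.subsetP => y; rewrite inE => ys; apply: (allP sN).
  have [S' [NE sS pE]] := subsystem_of_paths ui XS ok sub.
  apply: (bf _ S' sz sS); exists x, s; split=> //; last by rewrite -bsE.
  by move=> y; rewrite NE inE.
have rneq x y : r x < r y -> x != y by move=> l; apply: contraTneq l => ->; rewrite ltnn.
exists r; split; last first.
  by move=> i li; apply: (sorted_uniq tr irr); apply: (all_nthP [::] so).
split.
- move=> i x y xi yi E; have [xN yN] := (pN _ _ xi, pN _ _ yi).
  case/or3P: (tot _ _ xN yN) => [/eqP //|/rlt|/rlt]; rewrite E ltnn.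
    by move=> /(_ xN).
  by move=> /(_ yN).
- move=> i j x y nij hi hj.
  have [xN yN nxy si] := hopE _ _ _ hi; have [_ _ _ sj] := hopE _ _ _ hj.
  apply: (main [:: i; j] x [:: y] _ _ _ _ _ erefl) => //=.
  + by rewrite inE nij.
  + by rewrite inE nxy.
  + by rewrite xN yN.
  + by rewrite !inE !eqxx !orbT.
  + by rewrite si sj.
- move=> i j k x y z u hi hj hk.
  have [xN yN nxy si] := hopE _ _ _ hi; have [_ zN nyz sj] := hopE _ _ _ hj.
  have [_ _ nxz sk] := hopE _ _ _ hk.
  apply: (main [:: k; i; j] x [:: y; z] _ _ _ _ _ erefl) => //=.
  + by move: u; rewrite -(rot_uniq 2).
  + by rewrite !inE negb_or nxy nyz nxz.
  + by rewrite xN yN zN.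
  + by rewrite !inE !eqxx !orbT.
  + by rewrite si sj sk.
- move=> i j k l x y z t u hi hj hk hl.
  have [xN yN nxy si] := hopE _ _ _ hi; have [_ zN nyz sj] := hopE _ _ _ hj.
  have [_ tN nzt sk] := hopE _ _ _ hk; have [_ _ nxt sl] := hopE _ _ _ hl.
  have [/and3P[_ _ lxy] /and3P[_ _ lyz] /and3P[_ _ lzt]] := And3 hi hj hk.
  have nxz := rneq _ _ (ltn_trans lxy lyz); have nyt := rneq _ _ (ltn_trans lyz lzt).
  apply: (main [:: l; i; j; k] x [:: y; z; t] _ _ _ _ _ erefl) => //=.
  + by move: u; rewrite -(rot_uniq 3).
  + by rewrite !inE !negb_or nxy nyz nxz nxt nyt nzt.
  + by rewrite xN yN zN tN.
  + by rewrite !inE !eqxx !orbT.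
  + by rewrite si sj sk sl.
Qed.

(** * The ladder count for paths of equal length *)

(** By the lower bound on [#|I| * l], equalising the degrees loses at most half of the incidences.
    Convexity then leaves at least [#|I| * l ^ 2 / 16] ordered pairs, and [D ^ 2 <= 4 * D.-1 ^ 2]
    makes the factor 64. *)
Lemma regular_ladder_count (V I : finType) (r : V -> nat) (A : I -> {set V})
    (M : {set V}) l n D m :
  bridgeless r A -> (forall i, #|A i| = l) -> (forall i, A i \subset M) ->
  (#|M| <= n)%N -> (8 <= l)%N -> (2 <= D)%N -> (D.-1 * 2 * n <= #|I| * l)%N ->
  (0 < m)%N ->
  exists (V' : finType) (r' : V' -> nat) (A' M' : I -> {set V'}),
    [/\ bridgeless r' A', forall i, (#|A' i| <= l)%N,
        forall s, (#|M' s| <= l * D * m.-1)%N,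
        forall s, (\sum_j #|A' j :&: M' s| <= D * #|M' s|)%N &
        (D ^ 2 * #|I| * l ^ 2 <=
         64 * (2 * (l %/ m).+1 * #|I| ^ 2 + \sum_s \sum_j #|A' j :&: M' s| ^ 2))%N].
Proof.
move=> br lenA AM cM l8 D2 Dn m0.
have D0 : (0 < D)%N by apply: leq_trans D2.
have [V' [r' [A' [br' len' deg' tot]]]] := regularize_degrees br lenA AM cM D0.
have [M' [cM' cnt]] := ladder_count br' len' deg' m0.
exists V', r', A', M'; split=> // [s|].
  under eq_bigr do rewrite -sum1_card big_mkcond /=.
  rewrite exchange_big /= mulnC -sum_nat_const big_mkcond /=.
  rewrite [leqRHS]big_mkcond /=; apply: leq_sum => v _.
  case: (boolP (v \in M' s)) => vM; last first.
    by rewrite big1 // => j _; rewrite !inE (negbTE vM) andbF.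
  rewrite -big_mkcond sum1dep_card.
  apply: (leq_trans (n := #|[set j | v \in A' j]|)).
    by apply/eq_leq/eq_card => j; rewrite !inE vM andbT.
  have [->|[j]] := set_0Vmem [set j | v \in A' j]; first by rewrite cards0.
  by rewrite inE => /deg' ->.
pose a s := #|A' s|; pose u s := #|[set u in finset.setX (A' s) (A' s) | (r' u.1 < r' u.2)%N]|.
have uE s : (u s * 2 + a s = a s ^ 2)%N.
  by apply: card_ordered_pairs; case: br' => injr _ _ _; apply: injr.
(* This sums [(2 * a s - l) ^ 2 >= 0], with the square of [a s] expressed by [uE]. *)
have T1 : (4 * l * \sum_s a s <= 8 * \sum_s u s + 4 * \sum_s a s + #|I| * l ^ 2)%N.
  rewrite -sum_nat_const !big_distrr -!big_split /=; apply: leq_sum => s _; have := uE s; rewrite -!mulnn; move: (a s) (u s) => x y.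
  by have := (nat_Cauchy (2 * x) l).1; rewrite -!mulnn; clear; nia.
have T2 : (\sum_s a s <= #|I| * l)%N.
  by rewrite -sum_nat_const; apply: leq_sum => s _; apply: len'.
move: cnt tot T1 T2; rewrite -[\sum_s #|[set _ in _ | _]|]/(\sum_s u s).
rewrite -[\sum_i #|A' i|]/(\sum_s a s).
move: (\sum_s u s)%N (\sum_s a s)%N (\sum_s \sum_j _)%N => U S W cnt tot T1 T2.
have H1 : (#|I| * l ^ 2 <= 16 * U)%N.
  have h1 : (#|I| * l <= 2 * S)%N by move: tot Dn; rewrite -mulnA [(2 * n)%N]mulnC mulnA; lia.
  have h2 := leq_mul (leqnn l) h1; have h3 := leq_mul l8 (leqnn (#|I| * l)).
  have E : (#|I| * l ^ 2 = l * (#|I| * l))%N by rewrite -mulnn; ring.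
  rewrite E in T1 *; move: h1 h2 h3 T1 T2; rewrite -!mulnA [(l * (2 * _))%N]mulnCA.
  by move: (#|I| * l)%N (l * S)%N (l * (#|I| * l))%N; clear; lia.
have H2 : (D ^ 2 <= 4 * D.-1 ^ 2)%N by rewrite -!mulnn; nia.
apply: (leq_trans (n := (64 * (D.-1 ^ 2 * U)))).
  by have := leq_mul H2 H1; rewrite !mulnA; lia.
by rewrite leq_mul2l cnt.
Qed.

Local Open Scope ring_scope.

(** * Numerical estimates *)

(** For [s >= 1] the summand is at most [c / (k + 1) ^ 2] with [c] the power [1 - s] of [k0], and
    [1 / (k + 1) ^ 2 <= 1 / k - 1 / (k + 1)] telescopes. *)
Lemma sum_powR_tail (R : realType) (s : R) (k0 l : nat) :
  1 <= s -> (0 < k0)%N ->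
  \sum_(k0 <= k < l) k.+1%:R `^ (- (1 + s)) <= k0%:R `^ (- s).
Proof.
move=> s1 k00; have k0R : (0 : R) < k0%:R by rewrite ltr0n.
have [le|lt] := leqP l k0; first by rewrite big_geq // powR_ge0.
pose c : R := k0%:R `^ (1 - s).
have cE : c = (k0%:R `^ (s - 1))^-1 by rewrite /c -opprB powRN.
have c0 : 0 <= c by exact: powR_ge0.
have step k : (k0 <= k)%N ->
    k.+1%:R `^ (- (1 + s)) <= c * k%:R^-1 - c * k.+1%:R^-1.
  move=> le; have kR : (0 : R) < k%:R by rewrite ltr0n (leq_trans k00).
  have kS : (0 : R) < k.+1%:R by [].
  apply: (@le_trans _ _ (c * k.+1%:R ^- 2)).
    have -> : - (1 + s) = - (s - 1) - 2%:R by lra.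
    rewrite powRD; last by rewrite (gt_eqF kS) implybT.
    rewrite !powRN powR_mulrn //; apply: ler_wpM2r; first by rewrite invr_ge0 exprn_ge0.
    rewrite cE lef_pV2 ?posrE ?powR_gt0 //.
    by apply: ge0_ler_powR; rewrite ?nnegrE ?ler_nat ?subr_ge0 // ltnW.
  rewrite -mulrBr; apply: ler_wpM2l => //; rewrite -subr_ge0.
  have -> : k%:R^-1 - k.+1%:R^-1 - k.+1%:R ^- 2 = (k%:R * k.+1%:R ^+ 2)^-1 :> R.
    by rewrite -natr1; field; rewrite natr1 !gt_eqF.
  by rewrite invr_ge0 mulr_ge0 ?exprn_ge0 // ltW.
apply: (@le_trans _ _ (\sum_(k0 <= k < l) (c * k%:R^-1 - c * k.+1%:R^-1))).
  by rewrite big_nat [leRHS]big_nat; apply: ler_sum => k /andP[le _]; apply: step.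
under eq_bigr do rewrite addrC -[c * _^-1 in X in _ + X]opprK.
rewrite (telescope_sumr (fun k : nat => - (c * k%:R^-1))) ?(ltnW lt) // opprK addrC.
apply: (@le_trans _ _ (c * k0%:R^-1)).
  by rewrite gerBl mulr_ge0 // invr_ge0 ler0n.
rewrite /c -powR_inv1 ?ler0n // -powRD; last by rewrite (gt_eqF k0R) implybT.
by have -> : 1 - s + -1 = - s by lra.
Qed.

(** From [ln (1 - x) <= - x] at [x = 1 / (k + 1)], each summand is at most [ln (k + 1) - ln k],
    which telescopes. *)
Lemma sum_inv_ln (R : realType) (k0 l : nat) :
  (0 < k0)%N -> (k0 <= l)%N ->
  \sum_(k0 <= k < l) k.+1%:R^-1 <= ln (l%:R / k0%:R : R).
Proof.
move=> k00 le; have k0R : (0 : R) < k0%:R by rewrite ltr0n.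
have lR : (0 : R) < l%:R by rewrite ltr0n; apply: leq_trans le.
rewrite ln_div ?posrE // -(telescope_sumr (fun k : nat => ln (k%:R : R)) le).
rewrite big_nat [leRHS]big_nat; apply: ler_sum => k /andP[lek _].
have kR : (0 : R) < k%:R by rewrite ltr0n; apply: leq_trans lek.
have kS : (0 : R) < k.+1%:R by [].
rewrite -lerN2 opprB -ln_div ?posrE //.
have -> : k%:R / k.+1%:R = 1 + - k.+1%:R^-1 :> R.
  by rewrite -natr1; field; rewrite natr1 gt_eqF.
by apply: le_ln1Dx; rewrite ltrN2 invf_lt1 // ltr1n ltnS (leq_trans k00).
Qed.

Lemma sqrt2_itv (R : realType) : 1 <= Num.sqrt 2 :> R /\ 12 * Num.sqrt 2 <= 17 :> R.
Proof.
have s0 : 0 <= Num.sqrt 2 :> R by exact: sqrtr_ge0.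
have ss : Num.sqrt 2 ^+ 2 = 2 :> R by rewrite sqr_sqrtr.
by split; rewrite -ler_sqr ?nnegrE ?mulr_ge0 // ?exprMn ss; lra.
Qed.

(** The logarithm of the fifth root of [y] is at most that root, and [5 ^ 5 = 3125]. *)
Lemma ln_pow5 (R : realType) (y : R) : 1 <= y -> ln y ^+ 5 <= 3125 * y.
Proof.
move=> y1; have y0 : 0 < y by lra.
have u0 : 0 <= ln y by exact: ln_ge0.
have le : ln y <= 5 * expR (ln y / 5).
  by have := expR_ge1Dx (ln y / 5); have := expR_ge0 (ln y / 5); lra.
apply: (le_trans (lerXn2r 5 _ _ le)); rewrite ?nnegrE ?mulr_ge0 ?expR_ge0 //.
rewrite exprMn -expRM_natl (_ : _ * (_ / 5) = ln y); last by rewrite mulrC divfK.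
by rewrite lnK // ler_wpM2r ?(ltW y0) //; lra.
Qed.

(* [P] paths of length [l] on [n] nodes of degree [D] are cut into blocks of
   length [m]; [2 ^ 13 * w] is the constant of the bound that fails. *)
Lemma counterexample_scales (R : realType) (n P l D m w : R) :
  0 < n -> 0 < P -> 1 <= l -> 0 < D -> 1 <= m -> 0 < w ->
  2 ^+ 13 * w * (n ^+ 2 * l `^ (- (2 + Num.sqrt 2)) + n * Num.sqrt n / l ^+ 2 + n / l)
    <= P ->
  P * l <= 2 * n * D -> m * D ^+ 2 * l <= 2 ^+ 11 * P ->
  [/\ w * m <= l `^ (Num.sqrt 2 - 1), (w * m) ^+ 12 <= l ^+ 5, w * m <= l &
      m * (2 ^+ 13 * w) * w <= 2 * D].
Proof.
move=> n0 P0 l1 D0 m1 w0 HP HD Hm.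
have l0 : 0 < l by lra.
have wm0 : 0 < w * m by rewrite mulr_gt0 //; lra.
have [s1 s2] := sqrt2_itv R; set s := Num.sqrt 2 in s1 s2 HP *.
have t1 : 0 <= n ^+ 2 * l `^ (- (2 + s)) by rewrite mulr_ge0 ?powR_ge0 // exprn_ge0 // ltW.
have t2 : 0 <= n * Num.sqrt n / l ^+ 2.
  by rewrite !mulr_ge0 ?sqrtr_ge0 ?invr_ge0 ?exprn_ge0 // ltW.
have t3 : 0 <= n / l by rewrite divr_ge0 // ltW.
have A0 : 0 < 2 ^+ 13 * w by rewrite mulr_gt0 ?exprn_gt0.
have B1 : w * m <= l `^ (s - 1).
  have H1 : 2 ^+ 13 * w * (n ^+ 2 * l `^ (- (2 + s))) <= P.
    by apply: le_trans HP; rewrite ler_pM2l //; lra.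
  (* Squaring [P * l <= 2 * n * D] and eliminating [D] by the upper bound on [m * D ^+ 2 * l]. *)
  have H2 : m * P * l ^+ 3 <= 2 ^+ 13 * n ^+ 2.
    rewrite -(ler_pM2r P0).
    apply: (@le_trans _ _ (m * l * (P * l) ^+ 2)); first by rewrite le_eqVlt; apply/orP; left; apply/eqP; ring.
    apply: (@le_trans _ _ (m * l * (2 * n * D) ^+ 2)).
      rewrite ler_wpM2l ?mulr_ge0 ?(ltW l0) //; first by lra.
      by apply: lerXn2r HD; rewrite nnegrE !mulr_ge0 // ltW.
    have -> : m * l * (2 * n * D) ^+ 2 = 4 * n ^+ 2 * (m * D ^+ 2 * l) by ring.
    have -> : 2 ^+ 13 * n ^+ 2 * P = 4 * n ^+ 2 * (2 ^+ 11 * P) by ring.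
    by rewrite ler_wpM2l // mulr_ge0 // exprn_ge0 // ltW.
  have H3 : m * (2 ^+ 13 * w * (n ^+ 2 * l `^ (- (2 + s)))) * l ^+ 3 <= 2 ^+ 13 * n ^+ 2.
    apply: le_trans H2; rewrite ler_wpM2r ?exprn_ge0 ?(ltW l0) //.
    by rewrite ler_wpM2l //; lra.
  have H4 : (w * m) * (l `^ (- (2 + s)) * l ^+ 3) <= 1.
    have n2 : 0 < 2 ^+ 13 * n ^+ 2 by rewrite mulr_gt0 ?exprn_gt0.
    rewrite -(ler_pM2l n2) mulr1; apply: le_trans H3.
    by rewrite le_eqVlt; apply/orP; left; apply/eqP; ring.
  move: H4; rewrite -(powR_mulrn 3 (ltW l0)) -powRD; last by rewrite (gt_eqF l0) implybT.
  have -> : - (2 + s) + 3%:R = - (s - 1) by lra.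
  by rewrite powRN ler_pdivrMr ?powR_gt0 // mul1r.
(* Here [12 * (Num.sqrt 2 - 1) <= 5] replaces the irrational exponent. *)
have B2 : (w * m) ^+ 12 <= l ^+ 5.
  apply: (le_trans (lerXn2r 12 _ _ B1)); rewrite ?nnegrE ?powR_ge0 ?(ltW wm0) //.
  have -> : (l `^ (s - 1)) ^+ 12 = l `^ ((s - 1) * 12%:R).
    by rewrite powRrM powR_mulrn ?powR_ge0.
  rewrite -(powR_mulrn 5 (ltW l0)).
  by apply: ler_powR => //; lra.
split=> //.
- rewrite -(ler_pXn2r (n := 12)) ?nnegrE ?(ltW wm0) ?(ltW l0) //.
  by apply: (le_trans B2); apply: ler_weXn2l.
- have H1 : 2 ^+ 13 * w * (n * Num.sqrt n / l ^+ 2) <= P.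
    by apply: le_trans HP; rewrite ler_pM2l //; lra.
  have H2 : (2 ^+ 13 * w) ^+ 2 * n ^+ 3 <= (P * l ^+ 2) ^+ 2.
    have H3 : 2 ^+ 13 * w * (n * Num.sqrt n) <= P * l ^+ 2.
      by move: H1; rewrite mulrA ler_pdivrMr ?exprn_gt0.
    apply: le_trans (lerXn2r 2 _ _ H3); last 2 first.
    - by rewrite nnegrE !mulr_ge0 ?sqrtr_ge0 // ltW.
    - by rewrite nnegrE mulr_ge0 ?exprn_ge0 // ltW.
    rewrite !exprMn sqr_sqrtr ?(ltW n0) //.
    by rewrite le_eqVlt; apply/orP; left; apply/eqP; ring.
  have H3 : (P * l) ^+ 3 <= (2 * n * D) ^+ 3.
    by apply: lerXn2r HD; rewrite nnegrE !mulr_ge0 // ltW.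
  (* The middle term of the failing bound and the cube of [P * l <= 2 * n * D] are combined so that
     [n] cancels. *)
  have H4 : 2 ^+ 10 * P * (2 ^+ 13 * w) * w <= D ^+ 3 * l.
    have n3 : 0 < 8 * n ^+ 3 by rewrite mulr_gt0 // exprn_gt0.
    rewrite -(ler_pM2l n3).
    apply: (@le_trans _ _ ((2 ^+ 13 * w) ^+ 2 * n ^+ 3 * P)).
      by rewrite le_eqVlt; apply/orP; left; apply/eqP; ring.
    apply: (@le_trans _ _ ((P * l ^+ 2) ^+ 2 * P)); first by rewrite ler_wpM2r // ltW.
    apply: (@le_trans _ _ ((P * l) ^+ 3 * l)).
      by rewrite le_eqVlt; apply/orP; left; apply/eqP; ring.
    apply: (@le_trans _ _ ((2 * n * D) ^+ 3 * l)); first by rewrite ler_wpM2r // ltW.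
    by rewrite le_eqVlt; apply/orP; left; apply/eqP; ring.
  have D2l : 0 < D ^+ 2 * l by rewrite mulr_gt0 // exprn_gt0.
  rewrite -(ler_pM2r D2l).
  apply: (@le_trans _ _ (2 ^+ 11 * P * ((2 ^+ 13 * w) * w))).
    have -> : m * (2 ^+ 13 * w) * w * (D ^+ 2 * l) = m * D ^+ 2 * l * ((2 ^+ 13 * w) * w) by ring.
    by rewrite ler_wpM2r // mulr_ge0 // ltW.
  have -> : 2 * D * (D ^+ 2 * l) = 2 * (D ^+ 3 * l) by ring.
  have -> : 2 ^+ 11 * P * (2 ^+ 13 * w * w) = 2 * (2 ^+ 10 * P * (2 ^+ 13 * w) * w) by ring.
  by rewrite ler_wpM2l.
Qed.

(** Here the exponent is a fixed point. With [s] for [Num.sqrt 2], [(s - 1) * (s + 1) = 1] turns the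
    bound on [x = w * m] into [x ^ (s + 1) <= l]; dividing by [2 ^+ 9 * m] and raising to the power
    [s], with [s * s = 2], produces [m ^+ 2] together with [w ^+ 3], which exceeds the linear
    constant. *)
Lemma main_term_small (R : realType) (l m k w : R) :
  1 <= l -> 1 <= m -> 2 ^+ 21 <= w -> w * m <= l `^ (Num.sqrt 2 - 1) ->
  l <= 2 ^+ 9 * m * k ->
  2 ^+ 10 * (2 ^+ 13 * w) * m ^+ 2 <= k `^ Num.sqrt 2.
Proof.
move=> l1 m1 hw hx hk.
have [s1 s2] := sqrt2_itv R; set s := Num.sqrt 2 in s1 s2 hx *.
have ss : s * s = 2 by rewrite -expr2 sqr_sqrtr.
have w0 : 0 < w by apply: lt_le_trans hw; rewrite exprn_gt0.
have w512 : 2 ^+ 9 <= w by apply: le_trans hw; rewrite ler_weXn2l // ler1n.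
set x := w * m in hx *.
have x0 : 0 < x by rewrite mulr_gt0 //; lra.
have H1 : x `^ s * x <= l.
  rewrite -[X in _ * X](powRr1 (ltW x0)) -powRD; last by rewrite (gt_eqF x0) implybT.
  apply: (@le_trans _ _ ((l `^ (s - 1)) `^ (s + 1))).
    by apply: ge0_ler_powR; rewrite ?nnegrE ?powR_ge0 ?(ltW x0) //; lra.
  rewrite -powRrM (_ : (s - 1) * (s + 1) = 1) ?powRr1 //; first by lra.
  by rewrite -subr_sqr_1 expr2 ss; lra.
have H2 : w / 2 ^+ 9 * x `^ s <= k.
  have m512 : 0 < 2 ^+ 9 * m by rewrite mulr_gt0 ?exprn_gt0 //; lra.
  rewrite -(ler_pM2l m512); apply: le_trans hk; apply: le_trans H1.
  by rewrite le_eqVlt; apply/orP; left; apply/eqP; rewrite /x; field.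
have w1 : 1 <= w / 2 ^+ 9 by rewrite ler_pdivlMr ?exprn_gt0 // mul1r.
have H3 : w / 2 ^+ 9 * x ^+ 2 <= k `^ s.
  apply: (@le_trans _ _ ((w / 2 ^+ 9 * x `^ s) `^ s)); last first.
    have p0 : 0 <= w / 2 ^+ 9 * x `^ s by rewrite mulr_ge0 ?powR_ge0 //; lra.
    apply: ge0_ler_powR; rewrite ?nnegrE //; first by lra.
    exact: le_trans H2.
  rewrite powRM ?powR_ge0 //; last by lra.
  rewrite -powRrM ss powR_mulrn ?(ltW x0) //.
  by rewrite ler_wpM2r ?exprn_ge0 ?(ltW x0) // le1r_powR.
apply: le_trans H3.
have -> : w / 2 ^+ 9 * x ^+ 2 = w * (w ^+ 2 / 2 ^+ 9) * m ^+ 2 by rewrite /x; ring.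
rewrite ler_wpM2r ?exprn_ge0 //; first by lra.
rewrite mulrA [_ * w]mulrC ler_wpM2l ?(ltW w0) // ler_pdivlMr ?exprn_gt0 //.
apply: (@le_trans _ _ ((2 ^+ 21) ^+ 2)).
  by rewrite -!exprD -exprM ler_weXn2l // ler1n.
by apply: lerXn2r hw; rewrite nnegrE ?exprn_ge0 // ltW.
Qed.

(** [H] stands for the logarithm of [l / k0]. The exponents 5 and 12 match: the fifth power of
    [m ^+ 2 * H ^+ 2] is of order [m ^+ 12], which [l ^+ 5] dominates. *)
Lemma middle_term_small (R : realType) (l m D H w : R) :
  1 <= l -> 1 <= m -> 2 ^+ 21 <= w -> 0 < D -> 0 <= H ->
  (w * m) ^+ 12 <= l ^+ 5 -> m * (2 ^+ 13 * w) * w <= 2 * D -> H ^+ 5 <= 2 ^+ 21 * m ->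
  2 ^+ 10 * (2 ^+ 13 * w) * (l * D * m * Num.sqrt (l * D * m) * H) <= (D * l) ^+ 2.
Proof.
move=> l1 m1 hw D0 H0 h12 hD hH.
have w0 : 0 < w by apply: lt_le_trans hw; rewrite exprn_gt0.
have l0 : 0 < l by lra.
have m0 : 0 < m by lra.
have E0 : 0 < l * D by rewrite mulr_gt0.
have A0 : 0 < 2 ^+ 13 * w by rewrite mulr_gt0 ?exprn_gt0.
have K1 : 2 ^+ 34 * m ^+ 2 * H ^+ 2 <= l.
  rewrite -(ler_pXn2r (n := 5)) ?nnegrE ?(ltW l0) //; last first.
    by rewrite !mulr_ge0 ?exprn_ge0 // ltW.
  have -> : (2 ^+ 34 * m ^+ 2 * H ^+ 2) ^+ 5 = 2 ^+ 170 * m ^+ 10 * (H ^+ 5) ^+ 2.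
    by ring.
  apply: (@le_trans _ _ (2 ^+ 170 * m ^+ 10 * (2 ^+ 21 * m) ^+ 2)).
    rewrite ler_wpM2l ?mulr_ge0 ?exprn_ge0 ?(ltW m0) //.
    by apply: lerXn2r hH; rewrite nnegrE ?mulr_ge0 ?exprn_ge0 // ltW.
  apply: le_trans h12.
  have -> : 2 ^+ 170 * m ^+ 10 * (2 ^+ 21 * m) ^+ 2 = 2 ^+ 212 * m ^+ 12 :> R.
    by ring.
  rewrite exprMn ler_wpM2r ?exprn_ge0 ?(ltW m0) //.
  apply: (@le_trans _ _ ((2 ^+ 21) ^+ 12)).
    by rewrite -exprM ler_weXn2l // ler1n.
  by apply: lerXn2r hw; rewrite nnegrE ?exprn_ge0 // ltW.
have K2 : (2 ^+ 10 * (2 ^+ 13 * w) * m * H) ^+ 2 * m <= l * D.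
  have -> : (2 ^+ 10 * (2 ^+ 13 * w) * m * H) ^+ 2 * m =
     2 ^+ 20 * 2 ^+ 13 * (m ^+ 2 * H ^+ 2) * (m * (2 ^+ 13 * w) * w) by ring.
  apply: (@le_trans _ _ (2 ^+ 20 * 2 ^+ 13 * (m ^+ 2 * H ^+ 2) * (2 * D))).
    by rewrite ler_wpM2l // !mulr_ge0 ?exprn_ge0 // ltW.
  rewrite mulrA ler_wpM2r ?(ltW D0) //; apply: le_trans K1.
  by rewrite le_eqVlt; apply/orP; left; apply/eqP; ring.
have K3 : 2 ^+ 10 * (2 ^+ 13 * w) * m * H * Num.sqrt (l * D * m) <= l * D.
  have c0 : 0 <= 2 ^+ 10 * (2 ^+ 13 * w) * m * H.
    by rewrite !mulr_ge0 ?exprn_ge0 // ltW.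
  rewrite -ler_sqr ?nnegrE ?(ltW E0) ?(mulr_ge0 c0 (sqrtr_ge0 _)) //.
  rewrite exprMn sqr_sqrtr; last by rewrite mulr_ge0 // ltW.
  have -> : (2 ^+ 10 * (2 ^+ 13 * w) * m * H) ^+ 2 * (l * D * m) =
    (2 ^+ 10 * (2 ^+ 13 * w) * m * H) ^+ 2 * m * (l * D) by ring.
  by rewrite [X in _ <= X]expr2 ler_pM2r.
have -> : (D * l) ^+ 2 = l * D * (l * D) by ring.
have -> : 2 ^+ 10 * (2 ^+ 13 * w) * (l * D * m * Num.sqrt (l * D * m) * H) =
   l * D * (2 ^+ 10 * (2 ^+ 13 * w) * m * H * Num.sqrt (l * D * m)) by ring.
by rewrite ler_pM2l.
Qed.

(** The weight [2 * k.+1] of a level raises each exponent of the assumed bound by one; the three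
    terms then sum to a power tail, a logarithm and a length. *)
Lemma sum_sqr_levels_le (R : realType) (I : finType) (L : I -> nat) (k0 l : nat) (a N : R) :
  0 <= a -> 0 <= N -> (0 < k0)%N -> (k0 <= l)%N -> (forall i, (L i <= l)%N) ->
  (forall k, (k0 <= k < l)%N -> #|[set i | (k < L i)%N]|%:R <=
    a * (N ^+ 2 * k.+1%:R `^ (- (2 + Num.sqrt 2)) + N * Num.sqrt N / k.+1%:R ^+ 2
         + N / k.+1%:R)) ->
  (\sum_i L i ^ 2)%:R <= k0%:R * (\sum_i L i)%:R +
    2 * a * (N ^+ 2 * k0%:R `^ (- Num.sqrt 2) + N * Num.sqrt N * ln (l%:R / k0%:R)
             + N * l%:R).
Proof.
move=> a0 N0 k00 k0l Ll lev.
have := sum_sqr_levels k0 Ll; rewrite -(ler_nat R) natrD natrM => H.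
apply: (le_trans H); rewrite lerD2l natr_sum.
have [s1 _] := sqrt2_itv R; set s := Num.sqrt 2 in s1 lev *.
apply: (@le_trans _ _ (\sum_(k0 <= k < l) 2 * a * (N ^+ 2 * k.+1%:R `^ (- (1 + s))
    + N * Num.sqrt N * k.+1%:R^-1 + N))).
  rewrite big_nat [leRHS]big_nat; apply: ler_sum => k kk.
  have kS : (0 : R) < k.+1%:R by [].
  rewrite 2!natrM -mulrA -[leRHS]mulrA ler_wpM2l //.
  apply: (le_trans (ler_wpM2l (ltW kS) (lev k kk))).
  have -> : k.+1%:R `^ (- (1 + s)) = k.+1%:R * k.+1%:R `^ (- (2 + s)).
    rewrite -[X in _ = X * _](powRr1 (ltW kS)) -powRD; last by rewrite (gt_eqF kS) implybT.
    by congr (_ `^ _); lra.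
  rewrite le_eqVlt; apply/orP; left; apply/eqP.
  by move: (_ `^ _) => z; field; rewrite gt_eqF.
rewrite -big_distrr ler_wpM2l ?mulr_ge0 //= !big_split /=.
rewrite -!big_distrr /= big_const_nat iter_addr_0.
apply: lerD; last by rewrite -[_ *+ _]mulr_natr ler_wpM2l // ler_nat leq_subr.
apply: lerD.
  by rewrite ler_wpM2l ?exprn_ge0 //; apply: sum_powR_tail.
by rewrite ler_wpM2l ?mulr_ge0 ?sqrtr_ge0 //; apply: sum_inv_ln.
Qed.

(** * The bound on the number of paths, by induction on the number of nodes *)

Definition path_bound (R : realType) (n k : nat) : R :=
  2 ^+ 34 * (n%:R ^+ 2 * k%:R `^ (- (2 + Num.sqrt 2))
             + n%:R * Num.sqrt n%:R / k%:R ^+ 2 + n%:R / k%:R).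

Definition path_bound_holds (R : realType) (n : nat) : Prop :=
  forall (V I : finType) (r : V -> nat) (A : I -> {set V}) (M : {set V}) k,
    (8 <= k)%N -> bridgeless r A -> (forall i, #|A i| = k) ->
    (forall i, A i \subset M) -> (#|M| <= n)%N -> #|I|%:R <= path_bound R n k.

(** Each trace on [M] is cut down to [k] of its nodes. Any [k] of them will do, since the order is
    carried by the rank. *)
Lemma path_bound_meeting (R : realType) (V I : finType) (r : V -> nat)
    (A : I -> {set V}) (M : {set V}) n k :
  path_bound_holds R n -> bridgeless r A -> (#|M| <= n)%N -> (8 <= k)%N ->
  #|[set j | (k <= #|A j :&: M|)%N]|%:R <= path_bound R n k.
Proof.
move=> ih br cM k8.
pose X := [set j | (k <= #|A j :&: M|)%N].
pose B (j : {j | j \in X}) := [set x in take k (enum (A (val j) :&: M))].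
have Bsub j x : x \in B j -> x \in A (val j) :&: M.
  by rewrite inE => /mem_take; rewrite mem_enum.
have -> : #|X| = #|{: {j | j \in X}}| by rewrite card_sig; apply: eq_card => j; rewrite inE.
apply: (ih _ _ r B M k k8) => //.
- apply: (bridgeless_refine (f := val) (g := id) br).
  + by move=> j x y _ _.
  + by move=> j x /Bsub; rewrite inE => /andP[].
  + by move=> i j x _ _ E; apply: val_inj.
- move=> j; have := valP j; rewrite inE cardE => le.
  rewrite cardsE (card_uniqP _) ?size_takel //.
  by rewrite take_uniq // enum_uniq.
- move=> j; apply/fintype.subsetP => x /Bsub; rewrite inE => /andP[//].
Qed.

Lemma path_bound_step (R : realType) (n : nat) :
  (forall n', (n' < n)%N -> path_bound_holds R n') -> path_bound_holds R n.
Proof.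
move=> IH V I r A M l l8 br lenA AM cM.
rewrite leNgt; apply/negP => big.
set P := #|I| in big.
have lR : (1 : R) <= l%:R by rewrite ler1n (leq_trans _ l8).
have l0 : (0 : R) < l%:R by lra.
have Pge0 : 0 <= path_bound R n l.
  by rewrite mulr_ge0 ?exprn_ge0 // !addr_ge0 ?mulr_ge0 ?powR_ge0 ?sqrtr_ge0 ?invr_ge0 ?exprn_ge0.
have PR : (0 : R) < P%:R by apply: le_lt_trans big.
have P0 : (0 < P)%N by rewrite -(ltr0n R).
have l_n : (l <= n)%N.
  have [i _] := card_gt0P P0; rewrite -(lenA i).
  by apply: leq_trans cM; apply: subset_leq_card.
have n0 : (0 < n)%N by apply: leq_trans l_n; apply: leq_trans l8.
have nR : (0 : R) < n%:R by rewrite ltr0n.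
(* The term [n / l] of the bound guarantees this, and with it [2 <= D]. *)
have Pl : (2 * n <= P * l)%N.
  rewrite -(ler_nat R) !natrM; apply: (@le_trans _ _ (2 ^+ 34 * (n%:R / l%:R) * l%:R)).
    by rewrite -mulrA divfK ?gt_eqF // ler_wpM2r ?(ltW nR) // ler_eXnr // ler1n.
  rewrite ler_pM2r //; apply: le_trans (ltW big); rewrite /path_bound ler_pM2l ?exprn_gt0 //.
  by rewrite lerDr addr_ge0 ?mulr_ge0 ?powR_ge0 ?sqrtr_ge0 ?invr_ge0 ?exprn_ge0.
pose D := ((P * l) %/ (2 * n)).+1.
have D2 : (2 <= D)%N by rewrite ltnS divn_gt0 ?muln_gt0.
have Dn : (D.-1 * 2 * n <= P * l)%N by rewrite -mulnA leq_trunc_div.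
have PlD : (P * l <= 2 * n * D)%N.
  by apply: ltnW; rewrite [(2 * n * D)%N]mulnC -ltn_divLR ?muln_gt0.
have DR : (0 : R) < D%:R by [].
have E0 : (0 : R) < D%:R ^+ 2 * l%:R by rewrite mulr_gt0 // exprn_gt0.
(* If ladders are too short for blocks, [m = 1] is used: [M'] is empty, and the count of unpaired
   rungs alone gives a contradiction. *)
have [small|large] := leqP (512 * P) (D ^ 2 * l).
  have [V' [r' [A' [M' [br' len' cM' deg' cnt]]]]] :=
    regular_ladder_count br lenA AM cM l8 D2 Dn (ltn0Sn 0).
  have S0 : (\sum_s \sum_j #|A' j :&: M' s| ^ 2 = 0)%N.
    rewrite big1 // => s _; rewrite big1 // => j _.
    have := cM' s; rewrite muln0 leqn0 cards_eq0 => /eqP ->.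
    by rewrite finset.setI0 cards0.
  move: cnt; rewrite S0 addn0 divn1 -/P leqNgt => /negP; apply.
  have h1 : (512 * P * (P * l) <= D ^ 2 * l * (P * l))%N by rewrite leq_mul2r small orbT.
  have -> : (D ^ 2 * P * l ^ 2 = D ^ 2 * l * (P * l))%N by ring.
  apply: leq_trans h1.
  have -> : (64 * (2 * l.+1 * P ^ 2) = 128 * (P * P) * l.+1)%N by ring.
  have -> : (512 * P * (P * l) = 128 * (P * P) * (4 * l))%N by ring.
  by rewrite ltn_pmul2l ?muln_gt0 ?P0 //; move: l8; clear; lia.
(* The least scale, up to rounding, at which unpaired rungs take up at most a quarter of the
   count. *)
pose m := ((1024 * P) %/ (D ^ 2 * l)).+1.
have D2l0 : (0 < D ^ 2 * l)%N by rewrite muln_gt0 expn_gt0 /=; apply: leq_trans l8.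
have m_ge : (1024 * P <= m * (D ^ 2 * l))%N by apply: ltnW; rewrite -ltn_divLR.
have m_le : (m * (D ^ 2 * l) <= 2048 * P)%N.
  rewrite mulSn; apply: (leq_trans (leq_add (ltnW large) (leq_trunc_div _ _))).
  by clear; lia.
have mR : (1 : R) <= m%:R by rewrite ler1n.
have m0 : (0 : R) < m%:R by [].
pose w : R := 2 ^+ 21.
have w0 : 0 < w by rewrite exprn_gt0.
have [c1 c2 c3 c4] : [/\ w * m%:R <= l%:R `^ (Num.sqrt 2 - 1),
    (w * m%:R) ^+ 12 <= l%:R ^+ 5, w * m%:R <= l%:R &
    m%:R * (2 ^+ 13 * w) * w <= 2 * D%:R].
  apply: (counterexample_scales nR PR lR DR mR w0).
  - by rewrite /w -exprD; apply: ltW big.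
  - by rewrite -!natrM ler_nat.
  - rewrite (_ : 2 ^+ 11 * P%:R = (2048 * P)%:R); last by rewrite natrM -natrX.
    by move: m_le; rewrite -(ler_nat R) !natrM -expr2 mulrA.
have c3n : (2 ^ 21 * m <= l)%N by move: c3; rewrite /w -natrX -natrM ler_nat.
(* Traces of length up to [k0] contribute at most [k0 * D * N], and this choice makes it at most
   [E / 2 ^+ 8]. *)
pose k0 := (l %/ (2 ^ 8 * m))%N.
have k0_le : (k0 * (2 ^ 8 * m) <= l)%N by exact: leq_trunc_div.
have k0_8 : (8 <= k0)%N.
  rewrite leq_divRL ?muln_gt0 //; apply: leq_trans c3n.
  by rewrite mulnA leq_mul2r; apply/orP; right.
have k0_ge : (l <= 2 ^ 9 * m * k0)%N.
  have : (l < k0.+1 * (2 ^ 8 * m))%N by rewrite -ltn_divLR ?muln_gt0.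
  move=> lt; apply: (leq_trans (ltnW lt)).
  have -> : (2 ^ 9 * m * k0 = 2 * k0 * (2 ^ 8 * m))%N by ring.
  by rewrite leq_mul2r; apply/orP; right; move: k0_8; clearbody k0; clear; lia.
have k0m_R : k0%:R * (2 ^+ 8 * m%:R) <= l%:R :> R by rewrite -natrX -!natrM ler_nat.
have k0g_R : l%:R <= 2 ^+ 9 * m%:R * k0%:R :> R by rewrite -natrX -!natrM ler_nat.
have k0l : (k0 <= l)%N by exact: leq_div.
have k0R : (0 : R) < k0%:R by rewrite ltr0n (leq_trans _ k0_8).
pose N := (l * D * m)%N.
(* The smaller system has [N * l <= 4096 * n] while [2 ^ 21 <= l], so the induction hypothesis
   applies to it. *)
have Nn : (N < n)%N.
  have h1 : (N * D * P <= 2048 * P * P)%N.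
    rewrite leq_mul2r; apply/orP; right; apply: leq_trans m_le.
    by apply/eq_leq; rewrite /N; ring.
  have h2 : (N * l * (D * P) <= 4096 * n * (D * P))%N.
    have -> : (N * l * (D * P) = N * D * P * l)%N by ring.
    apply: (leq_trans (leq_mul h1 (leqnn l))).
    have -> : (2048 * P * P * l = 2048 * P * (P * l))%N by ring.
    have -> : (4096 * n * (D * P) = 2048 * P * (2 * n * D))%N by ring.
    by rewrite leq_mul2l PlD orbT.
  move: h2; rewrite leq_pmul2r ?muln_gt0 ?P0 // => h2.
  have h3 : (4096 * n < n * l)%N.
    rewrite mulnC ltn_pmul2l //; apply: leq_trans c3n.
    by apply: (leq_trans (n := 2 ^ 21)); rewrite ?leq_pmulr // (_ : 4096 = 2 ^ 12)%N // ltn_exp2l.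
  by have := leq_ltn_trans h2 h3; rewrite ltn_mul2r => /andP[].
have [V' [r' [A' [M' [br' len' cM' deg' cnt]]]]] :=
    regular_ladder_count br lenA AM cM l8 D2 Dn (ltn0Sn _ : 0 < m)%N.
have cN s : (#|M' s| <= N)%N.
  by apply: (leq_trans (cM' s)); rewrite leq_mul2l leq_pred orbT.
have Ll s j : (#|A' j :&: M' s| <= l)%N.
  by apply: leq_trans (len' j); apply/subset_leq_card/fintype.subsetP => x; rewrite inE => /andP[].
pose E : R := (D%:R * l%:R) ^+ 2.
have EE0 : 0 < E by rewrite exprn_gt0 // mulr_gt0.
have sumL s : (\sum_j #|A' j :&: M' s| ^ 2)%:R <= E / 2 ^+ 8 + 6 * (E / 2 ^+ 10) :> R.
  have lev k : (k0 <= k < l)%N -> #|[set j | (k < #|A' j :&: M' s|)%N]|%:R <=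
      2 ^+ 34 * (N%:R ^+ 2 * k.+1%:R `^ (- (2 + Num.sqrt 2))
        + N%:R * Num.sqrt N%:R / k.+1%:R ^+ 2 + N%:R / k.+1%:R) :> R.
    move=> /andP[kk _]; have k8 : (8 <= k.+1)%N by apply: leqW; apply: leq_trans kk.
    exact: (path_bound_meeting (IH _ Nn) br' (cN s) k8).
  have a0 : (0 : R) <= 2 ^+ 34 by rewrite exprn_ge0.
  apply: (le_trans (sum_sqr_levels_le a0 (ler0n _ _) (leq_trans (ltn0Sn 7) k0_8) k0l (Ll s) lev)).
  have NE : N%:R = l%:R * D%:R * m%:R :> R by rewrite !natrM.
  have part0 : k0%:R * (\sum_j #|A' j :&: M' s|)%:R <= E / 2 ^+ 8.
    apply: (@le_trans _ _ (k0%:R * (D * N)%:R)).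
      by rewrite ler_wpM2l // ler_nat (leq_trans (deg' s)) // leq_mul2l cN orbT.
    rewrite ler_pdivlMr ?exprn_gt0 // natrM NE.
    have -> : k0%:R * (D%:R * (l%:R * D%:R * m%:R)) * 2 ^+ 8 =
      D%:R ^+ 2 * l%:R * (k0%:R * (2 ^+ 8 * m%:R)) :> R by ring.
    have -> : E = D%:R ^+ 2 * l%:R * l%:R by rewrite /E; ring.
    by rewrite ler_pM2l.
  have AE : 2 ^+ 34 = 2 ^+ 13 * w by rewrite /w -exprD.
  have part1 : 2 ^+ 34 * (N%:R ^+ 2 * k0%:R `^ (- Num.sqrt 2)) <= E / 2 ^+ 10.
    have kp : 0 < k0%:R `^ Num.sqrt 2 :> R by rewrite powR_gt0.
    have := main_term_small lR mR (lexx w) c1 k0g_R; rewrite -AE => H.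
    rewrite powRN ler_pdivlMr ?exprn_gt0 // mulrA [X in X <= _]mulrAC ler_pdivrMr //.
    have -> : 2 ^+ 34 * N%:R ^+ 2 * 2 ^+ 10 = E * (2 ^+ 10 * 2 ^+ 34 * m%:R ^+ 2).
      by rewrite NE /E; ring.
    by rewrite ler_pM2l.
  have part2 : 2 ^+ 34 * (N%:R * Num.sqrt N%:R * ln (l%:R / k0%:R)) <= E / 2 ^+ 10.
    have y1 : 1 <= l%:R / k0%:R :> R by rewrite ler_pdivlMr // mul1r ler_nat.
    have H5 : ln (l%:R / k0%:R) ^+ 5 <= 2 ^+ 21 * m%:R :> R.
      apply: (le_trans (ln_pow5 y1)).
      apply: (@le_trans _ _ (2 ^+ 12 * (2 ^+ 9 * m%:R))); last first.
        by rewrite mulrA -exprD.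
      apply: ler_pM; rewrite ?ler0n ?divr_ge0 //.
        by rewrite -natrX ler_nat.
      by rewrite ler_pdivrMr.
    have := middle_term_small lR mR (lexx w) DR (ln_ge0 y1) c2 c4 H5.
    by rewrite -AE -NE -/E -mulrA => H; rewrite ler_pdivlMr ?exprn_gt0 // mulrC.
  have part3 : 2 ^+ 34 * (N%:R * l%:R) <= E / 2 ^+ 10.
    rewrite ler_pdivlMr ?exprn_gt0 // NE AE.
    have -> : 2 ^+ 13 * w * (l%:R * D%:R * m%:R * l%:R) * 2 ^+ 10 =
      D%:R * l%:R ^+ 2 * (m%:R * (2 ^+ 13 * w) * 2 ^+ 10) by ring.
    have -> : E = D%:R * l%:R ^+ 2 * D%:R by rewrite /E; ring.
    rewrite ler_pM2l ?mulr_gt0 ?exprn_gt0 //.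
    have h : m%:R * (2 ^+ 13 * w) * (2 ^+ 10 * 2) <= 2 * D%:R.
      apply: le_trans c4; rewrite ler_wpM2l ?mulr_ge0 ?(ltW w0) ?exprn_ge0 //.
      by rewrite -exprSr /w ler_weXn2l // ler1n.
    by move: h; rewrite mulrA [_ * 2]mulrC ler_pM2l.
  move: part0 part1 part2 part3; rewrite -[2 * 2 ^+ 34 * _]mulrA !mulrDr.
  move: (k0%:R * _) (2 ^+ 34 * _) (2 ^+ 34 * _) (2 ^+ 34 * _) (E / 2 ^+ 8) (E / 2 ^+ 10).
  move=> x0 x1 x2 x3 y z; clear => *; lra.
have big_le : (\sum_s \sum_j #|A' j :&: M' s| ^ 2)%:R <= P%:R * (E / 2 ^+ 8 + 6 * (E / 2 ^+ 10)).
  rewrite natr_sum; apply: (le_trans (ler_sum _ (fun s _ => sumL s))).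
  rewrite sumr_const -[X in X <= _]mulr_natl ler_wpM2r ?ler_nat ?max_card //.
  by rewrite addr_ge0 ?mulr_ge0 ?invr_ge0 ?exprn_ge0 ?(ltW EE0).
have first_le : (2 * (l %/ m).+1 * P ^ 2)%:R <= P%:R * (E / 2 ^+ 8).
  have ml : (m <= l)%N by apply: leq_trans c3n; rewrite leq_pmull // expn_gt0.
  have h1 : ((l %/ m).+1 * m <= 2 * l)%N.
    by rewrite mulSn mul2n -addnn leq_add // leq_trunc_div.
  have h2 : (2 * (l %/ m).+1 * P ^ 2 * 2 ^ 8 * m <= P * (D ^ 2 * l ^ 2) * m)%N.
    have -> : (2 * (l %/ m).+1 * P ^ 2 * 2 ^ 8 * m = 2 ^ 9 * P ^ 2 * ((l %/ m).+1 * m))%N by ring.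
    have -> : (P * (D ^ 2 * l ^ 2) * m = P * l * (m * (D ^ 2 * l)))%N by ring.
    apply: (leq_trans (leq_mul (leqnn _) h1)).
    have -> : (2 ^ 9 * P ^ 2 * (2 * l) = P * l * (1024 * P))%N by ring.
    by rewrite leq_mul2l m_ge orbT.
  rewrite leq_pmul2r // in h2.
  rewrite mulrA ler_pdivlMr ?exprn_gt0 //.
  have -> : P%:R * E = (P * (D ^ 2 * l ^ 2))%:R by rewrite /E !natrM -!expr2 exprMn.
  by rewrite -natrX -natrM ler_nat.
have : (D ^ 2 * P * l ^ 2)%:R <= (64 * (2 * (l %/ m).+1 * P ^ 2
    + \sum_s \sum_j #|A' j :&: M' s| ^ 2))%:R :> R by rewrite ler_nat.
have -> : (D ^ 2 * P * l ^ 2)%:R = P%:R * E :> R.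
  by rewrite /E !natrM -!expr2 exprMn; ring.
rewrite natrM natrD; have PE : 0 < P%:R * E by rewrite mulr_gt0.
(* The contributions add up to [64 * (2 / 2 ^ 8 + 6 / 2 ^ 10) = 7 / 8] of the left side. *)
have E8 : P%:R * (E / 2 ^+ 8) = P%:R * E / 2 ^+ 8 by rewrite mulrA.
have E10 : P%:R * (E / 2 ^+ 8 + 6 * (E / 2 ^+ 10)) =
    P%:R * E / 2 ^+ 8 + 6 * (P%:R * E / 2 ^+ 10) by ring.
move: big_le first_le PE; rewrite E8 E10.
move: (P%:R * E) (\sum_s _)%:R (2 * _ * _)%:R => x y z; clear => *; lra.
Qed.

Lemma path_bound_all (R : realType) (n : nat) : path_bound_holds R n.
Proof. by elim/ltn_ind: n => n IH; apply: path_bound_step. Qed.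

(** * From the number of paths to the size of a system *)

Lemma card_chunks k L b : (0 < k)%N -> (L <= b)%N ->
  #|[set c : 'I_b | (c.+1 * k <= L)%N]| = (L %/ k)%N.
Proof.
move=> k0 Lb; have -> : (L %/ k = \sum_(i < L %/ k) 1)%N by rewrite sum1_card card_ord.
rewrite (big_ord_widen b (fun=> 1%N)); last exact: leq_trans (leq_div _ _) Lb.
by rewrite -[LHS]sum1_card; apply: eq_bigl => c; rewrite inE leq_divRL.
Qed.

(** Cutting every path into chunks of length [k] wastes less than [k] per path, so at most half of
    the size; at least [p] chunks remain. *)
Lemma path_bound_system (R : realType) (T : finType) (S : path_system T) (n p k : nat) :
  (#|nodes S| <= n)%N -> (size (paths S) <= p)%N -> (0 < p)%N -> acyclic S ->
  bridge_free 4 S -> (8 <= k)%N -> (2 * p * k <= system_size S)%N ->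
  (k <= n)%N /\ p%:R <= path_bound R n k.
Proof.
move=> cn cp p0 ac bf k8 sz; have k0 : (0 < k)%N by apply: leq_trans k8.
have [r [br un]] := bridgeless_paths ac bf.
pose P := size (paths S); pose path (i : 'I_P) := nth [::] (paths S) i.
pose s := system_size S.
have sE : s = (\sum_i size (path i))%N.
  by rewrite /s /system_size (big_nth [::]) big_mkord.
have size_le i : (size (path i) <= s)%N by rewrite sE (bigD1 i) //= leq_addr.
pose F i := [set c : 'I_s | (c.+1 * k <= size (path i))%N].
pose X := [set q : 'I_P * 'I_s | q.2 \in F q.1].
pose A (q : {q | q \in X}) := [set x in chunk k (val q).2 (path (val q).1)].
have okP (q : {q | q \in X}) : ((val (val q).2).+1 * k <= size (path (val q).1))%N.
  by have := valP q; rewrite !inE.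
have brA : bridgeless r A.
  apply: (bridgeless_refine (f := fun q => (val q).1) (g := id) br).
  - by move=> q x y _ _.
  - by move=> q x; rewrite !inE => /mem_chunk.
  - move=> q q' x; rewrite !inE => xq xq' E; apply: val_inj.
    move: (val q) (val q') xq xq' E => [i c] [i' c'] /= xc xc' E; subst i'.
    congr pair; apply: val_inj => /=.
    by rewrite -(index_chunk (un _ (ltn_ord i)) xc) (index_chunk (un _ (ltn_ord i)) xc').
have lenA q : #|A q| = k.
  have uq : uniq (chunk k (val q).2 (path (val q).1)).
    by rewrite /chunk take_uniq // drop_uniq // un.
  by rewrite cardsE (card_uniqP uq) size_chunk // okP.
have AM q : A q \subset nodes S.
  apply/fintype.subsetP => x; rewrite inE => /mem_chunk xi.
  have /andP[_ /allP] := all_nthP [::] (pathsP S) _ (ltn_ord (val q).1).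
  exact.
have cX : (p <= #|X|)%N.
  rewrite (card_dep_pairs F) -(leq_pmul2r k0).
  have cF i : (size (path i) <= #|F i| * k + k)%N.
    by rewrite card_chunks // {1}(divn_eq (size (path i)) k) leq_add2l ltnW // ltn_pmod.
  have le : (\sum_i size (path i) <= (\sum_i #|F i|) * k + P * k)%N.
    apply: (leq_trans (n := \sum_i (#|F i| * k + k)%N)); first exact: leq_sum.
    by rewrite big_split /= sum_nat_const card_ord big_distrl.
  rewrite -sE in le; have : (P * k <= p * k)%N by rewrite leq_mul2r cp orbT.
  move: sz le; rewrite -/s -mulnA.
  by move: (p * k)%N (P * k)%N (_ * k)%N; clear; lia.
have cI : (p <= #|{: {q | q \in X}}|)%N.
  by rewrite card_sig (eq_card (B := X)) // => q; rewrite !inE.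
split.
  have [q _] := card_gt0P (leq_trans p0 cI).
  by rewrite -(lenA q); apply: leq_trans cn; apply: subset_leq_card.
by apply: le_trans (path_bound_all R k8 brA lenA AM cn); rewrite ler_nat.
Qed.

Lemma path_bound_solve (R : realType) (n p k : R) :
  0 < n -> 0 < p -> 0 < k ->
  p <= 2 ^+ 34 * (n ^+ 2 * k `^ (- (2 + Num.sqrt 2)) + n * Num.sqrt n / k ^+ 2 + n / k) ->
  p * k <= 2 ^+ 36 * (n + n `^ (3 / 4) * p `^ (1 / 2)
    + n `^ (2 - Num.sqrt 2) * p `^ (1 / Num.sqrt 2)).
Proof.
move=> n0 p0 k0; have [s1 s2] := sqrt2_itv R; set s := Num.sqrt 2 in s1 s2 *.
have ss : s * s = 2 by rewrite -expr2 sqr_sqrtr.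
have s0 : 0 < s by lra.
have pk0 : 0 < p * k by rewrite mulr_gt0.
set X := n ^+ 2 * _; set Y := n * _ / _; set Z := n / k => H.
set x := n `^ (2 - s) * _; set y := n `^ (3 / 4) * _.
have x0 : 0 < x by rewrite mulr_gt0 ?powR_gt0.
have y0 : 0 < y by rewrite mulr_gt0 ?powR_gt0.
pose a : R := 2 ^+ 36; have a1 : 1 <= a by rewrite exprn_ege1 // ler1n.
have a0 : 0 < a by lra.
rewrite -/a.
(* The constant [a] is four times the given one, so one of the three terms must carry a quarter of
   [p]. *)
have [hX|[hY|hZ]] : p <= a * X \/ p <= a * Y \/ p <= a * Z.
  have [|nX] := leP p (a * X); first by left.
  have [|nY] := leP p (a * Y); first by right; left.
  right; right; move: H nX nY; have -> : a = 2 ^+ 34 * 4 by rewrite /a (exprD _ 34 2); congr (_ * _); ring.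
  rewrite mulrDr mulrDr ![2 ^+ 34 * 4 * _]mulrAC.
  move: (2 ^+ 34 * X) (2 ^+ 34 * Y) (2 ^+ 34 * Z) => X' Y' Z'.
  by clear -p0; lra.
- apply: (@le_trans _ _ (a * x)); last first.
    by rewrite ler_pM2l // lerDr addr_ge0 // ltW.
  have g0 : 0 < 2 + s by lra.
  rewrite leNgt; apply/negP => lt.
  have ax0 : 0 <= a * x by rewrite mulr_ge0 // ltW.
  (* Compared at the power [2 + s]: [(2 - s) * (2 + s) = 2] and [(2 + s) / s = 1 + s] give exactly
     the exponents of [n] and [p]. *)
  have := gt0_ltr_powR g0 ax0 (ltW pk0) lt; rewrite ltNge => /negP; apply.
  rewrite powRM ?(ltW p0) ?(ltW k0) // powRM ?(ltW a0) ?(ltW x0) //.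
  rewrite /x powRM ?powR_ge0 // -!powRrM.
  have -> : (2 - s) * (2 + s) = 2%:R.
    by have -> : (2 - s) * (2 + s) = 4 - s * s; [ring | rewrite ss; ring].
  have -> : 1 / s * (2 + s) = 1 + s.
    have -> : 2 + s = s * (1 + s) by rewrite mulrDr mulr1 ss addrC.
    by field; rewrite gt_eqF.
  have -> : p `^ (2 + s) = p * p `^ (1 + s).
    rewrite -[X in _ = X * _](powRr1 (ltW p0)) -powRD; last by rewrite (gt_eqF p0) implybT.
    by congr (_ `^ _); ring.
  rewrite powR_mulrn ?(ltW n0) //.
  have hk : p * k `^ (2 + s) <= a * n ^+ 2.
    by move: hX; rewrite /X powRN mulrA ler_pdivlMr ?powR_gt0.
  have ha : a <= a `^ (2 + s) by apply: le1r_powR => //; lra.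
  have -> : p * p `^ (1 + s) * k `^ (2 + s) = p * k `^ (2 + s) * p `^ (1 + s) by ring.
  rewrite mulrA ler_wpM2r ?powR_ge0 //; apply: (le_trans hk).
  by rewrite ler_wpM2r ?exprn_ge0 // ltW.
- apply: (@le_trans _ _ (a * y)); last first.
    by rewrite (ler_pM2l a0) -addrA addrCA lerDl addr_ge0 // ltW.
  rewrite -ler_sqr ?nnegrE ?(ltW pk0) ?(mulr_ge0 (ltW a0) (ltW y0)) //.
  have y2 : y ^+ 2 = n * Num.sqrt n * p.
    rewrite /y exprMn -!powR_mulrn ?powR_ge0 // -!powRrM.
    have -> : 3 / 4 * 2%:R = 1 + 2^-1 :> R by field.
    have -> : 1 / 2 * 2%:R = 1 :> R by field.
    rewrite powRr1 ?(ltW p0) // powRD; last by rewrite (gt_eqF n0) implybT.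
    by rewrite powRr1 ?(ltW n0) // powR12_sqrt // ltW.
  have hk : p * k ^+ 2 <= a * (n * Num.sqrt n).
    by move: hY; rewrite /Y mulrA ler_pdivlMr ?exprn_gt0.
  rewrite [X in _ <= X]exprMn y2.
  have -> : (p * k) ^+ 2 = p * k ^+ 2 * p by ring.
  rewrite [X in _ <= X]mulrA ler_wpM2r ?(ltW p0) //; apply: (le_trans hk).
  rewrite ler_wpM2r ?mulr_ge0 ?sqrtr_ge0 ?(ltW n0) //.
  by rewrite -[X in X <= _]expr1 ler_weXn2l.
- apply: (@le_trans _ _ (a * n)); last first.
    by rewrite (ler_pM2l a0) -addrA lerDl addr_ge0 // ltW.
  by move: hZ; rewrite /Z mulrA ler_pdivlMr.
Qed.

Lemma system_size_bound (R : realType) (T : finType) (S : path_system T) (n p : nat) :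
  (#|nodes S| <= n)%N -> (size (paths S) <= p)%N -> acyclic S -> bridge_free 4 S ->
  (system_size S)%:R <= 2 ^+ 38 * (n%:R + n%:R `^ (3 / 4) * p%:R `^ (1 / 2)
    + n%:R `^ (2 - Num.sqrt 2) * p%:R `^ (1 / Num.sqrt 2) + p%:R) :> R.
Proof.
move=> cn cp ac bf; set s := system_size S; set B := (X in _ <= _ * (X + _)).
have B0 : 0 <= B by rewrite !addr_ge0 ?mulr_ge0 ?powR_ge0.
have [p0|p0] := posnP p.
  have -> : s = 0%N.
    by move: cp; rewrite p0 leqn0 size_eq0 /s /system_size => /eqP ->; rewrite big_nil.
  by rewrite mulr_ge0 ?exprn_ge0 ?addr_ge0.
(* Half the average path length. If it is below 8, the term [p] suffices; otherwise [k.+1 <= 2 * k]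
   costs only another factor 2. *)
pose k := (s %/ (2 * p))%N.
have s_lt : (s < 2 * p * k.+1)%N by rewrite mulnC -ltn_divLR ?muln_gt0.
have [k8|k8] := ltnP k 8.
  apply: (@le_trans _ _ (2 ^+ 38 * p%:R)); last by rewrite ler_pM2l ?exprn_gt0 // lerDr.
  apply: (@le_trans _ _ (2 ^+ 4 * p%:R)); last first.
    by rewrite ler_wpM2r // ler_weXn2l // ler1n.
  rewrite -natrX -natrM ler_nat; apply: (leq_trans (ltnW s_lt)).
  by rewrite mulnAC leq_mul2r; apply/orP; right; move: k8; clearbody k; clear; lia.
have k0 : (0 < k)%N by apply: leq_trans k8.
have [kn pb] : (k <= n)%N /\ p%:R <= path_bound R n k.
  by apply: path_bound_system cn cp p0 ac bf k8 _; rewrite mulnC leq_trunc_div.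
have n0 : (0 < n)%N by apply: leq_trans kn.
have := path_bound_solve (n := n%:R) (p := p%:R) (k := k%:R) _ _ _ pb.
rewrite !ltr0n => /(_ n0 p0 k0) pk.
apply: (@le_trans _ _ (2 ^+ 2 * (p%:R * k%:R))).
  rewrite -natrX -!natrM ler_nat; apply: (leq_trans (ltnW s_lt)).
  rewrite mulnA [(2 ^ 2)%N]mulnC -!mulnA leq_mul2l /= mulnCA leq_mul2l; apply/orP; right.
  by move: k8; clearbody k; clear; lia.
apply: (@le_trans _ _ (2 ^+ 2 * (2 ^+ 36 * B))); first by rewrite ler_pM2l ?exprn_gt0.
by rewrite mulrA -exprD ler_pM2l ?exprn_gt0 // lerDl.
Qed.

Local Open Scope classical_set_scope.
Local Open Scope ring_scope.

Theorem theorem46 (R : realType) :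
  exists (C : R) (e : nat -> R),
    [/\ 0 < C,
        e n @[n --> \oo] --> (0 : R) &
        forall n p : nat,
          (beta R n p 4 <=
             (C * (n%:R
                   + n%:R `^ (3 / 4) * p%:R `^ (1 / 2)
                   + n%:R `^ (2 - Num.sqrt 2 + e n) * p%:R `^ (1 / Num.sqrt 2)
                   + p%:R))%:E)%E].
Proof.
exists (2 ^+ 38), (fun=> 0); split.
- by rewrite exprn_gt0.
- exact: cvg_cst.
- move=> n p; apply: ge_ereal_sup => _ [T [S [cn cp ac bf ->]]].
  by rewrite lee_fin addr0; apply: system_size_bound.
Qed.
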